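(* Let $K=K_{\alpha,\theta,h}$ and $u\in H^2(K)$. For any point $\mathbf{x}_0\in K$ (not on the line through $p_1$ and $p_3$, so that the subtriangle $\widetilde K=p_1\mathbf{x}_0p_3$ is nondegenerate), $$ |(u-\Pi^Lu)(\mathbf{x}_0)|\le\frac{\sqrt{2|p_1\mathbf{x}_0|}}{\sqrt{H_{\widetilde K}}}\left(C_1(\alpha,\theta)\,h\,h_K+C_1(\alpha,\theta)^2h^2\right)^{1/2}|u|_{2,K}. $$
   Context: For $h>0$, $0<\alpha\le1$, $\cos^{-1}(\alpha/2)\le\theta<\pi$, $K_{\alpha,\theta,h}$ is the (closed) triangle with vertices $p_1=(0,0)$, $p_2=(h,0)$, $p_3=(\alpha h\cos\theta,\alpha h\sin\theta)$; $h$ is its medium edge length, and $h_K$ denotes the longest edge length of $K$. For $u\in H^2(K)$, $\Pi^Lu$ is the affine function on $K$ agreeing with $u$ at the three vertices. $|u|_{1,K}$ is the $H^1$-seminorm ($L^2$-norm of the gradient) and $|u|_{2,K}$ the $H^2$-seminorm, $|u|_{2,K}^2=\int_K(u_{xx}^2+u_{xy}^2+u_{yx}^2+u_{yy}^2)\,dK$. $C_1(\alpha,\theta)$ is a constant such that $|u-\Pi^Lu|_{1,K}\le C_1(\alpha,\theta)\,h\,|u|_{2,K}$ for all $u\in H^2(K)$. $|p_1\mathbf{x}_0|$ is the length of the segment from $p_1$ to $\mathbf{x}_0$, and $H_{\widetilde K}$ is the height of the triangle $\widetilde K$ with vertices $p_1,\mathbf{x}_0,p_3$ with respect to the base $p_1\mathbf{x}_0$.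 *)

(* Defs.v *)
From HB Require Import structures.
From mathcomp Require Import all_boot all_order all_algebra.
From mathcomp Require Import all_classical all_reals all_analysis.
From mathcomp Require Import ring.

Set Implicit Arguments.
Unset Strict Implicit.
Unset Printing Implicit Defensive.

Import Order.TTheory GRing.Theory Num.Theory.
Import numFieldNormedType.Exports.

Local Open Scope classical_set_scope.
Local Open Scope ring_scope.

Section PlaneGeometry.
Context {R : realType}.
Implicit Types a b c x : R * R.

Definition dot a b : R := a.1 * b.1 + a.2 * b.2.

(* The library norm on R * R is the sup norm, hence an explicit Euclidean
   length. *)
Definition dist a b : R := Num.sqrt (dot (b - a) (b - a)).

Definition line a b : set (R * R) :=
  [set x | exists t : R, x = a + t *: (b - a)].

Definition triangle a b c : set (R * R) :=
  [set x | exists r s t : R, [/\ 0 <= r, 0 <= s, 0 <= t, r + s + t = 1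
                               & x = r *: a + s *: b + t *: c]].

Definition longest_edge a b c : R :=
  Num.max (dist a b) (Num.max (dist b c) (dist c a)).

(* Foot of the perpendicular dropped from c onto the line through a and b
   (meaningful for a <> b). *)
Definition foot a b c : R * R :=
  a + (dot (c - a) (b - a) / dot (b - a) (b - a)) *: (b - a).

(* Height of the triangle a b c with respect to the base a b. *)
Definition height a b c : R := dist c (foot a b c).

Definition affine (f : R * R -> R) : Prop :=
  exists k l m : R, forall x, f x = k + l * x.1 + m * x.2.

(* For non-collinear a, b, c the set below is a singleton. *)
Definition lagrange a b c (u : R * R -> R) : R * R -> R :=
  xget (cst 0)
    [set f | [/\ affine f, f a = u a, f b = u b & f c = u c]].

Lemma lagrange_spec a b c u :
  (b.1 - a.1) * (c.2 - a.2) - (b.2 - a.2) * (c.1 - a.1) != 0 ->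
  [/\ affine (lagrange a b c u), lagrange a b c u a = u a,
      lagrange a b c u b = u b & lagrange a b c u c = u c].
Proof.
case: a b c => [a1 a2] [b1 b2] [c1 c2] /= D0.
rewrite /lagrange; case: xgetP => [f _ //|nof]; exfalso.
pose D := (b1 - a1) * (c2 - a2) - (b2 - a2) * (c1 - a1).
pose vb := u (b1, b2) - u (a1, a2); pose vc := u (c1, c2) - u (a1, a2).
pose l := (vb * (c2 - a2) - (b2 - a2) * vc) / D.
pose m := ((b1 - a1) * vc - vb * (c1 - a1)) / D.
apply: (nof (fun x => (u (a1, a2) - l * a1 - m * a2) + l * x.1 + m * x.2)).
split; first by exists (u (a1, a2) - l * a1 - m * a2), l, m.
- by rewrite /=; ring.
- by rewrite /= /l /m /vb /vc /D; field.
- by rewrite /= /l /m /vb /vc /D; field.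
Qed.

End PlaneGeometry.

Section Sobolev.
Context {R : realType}.
Implicit Types (K : set (R * R)) (f g u phi : R * R -> R) (i j : 'I_2).

Local Notation area := (@lebesgue_measure R \x @lebesgue_measure R)%E.

Definition unit_vec i : R * R := if i == ord0 then (1, 0) else (0, 1).

Definition partial i f : R * R -> R := fun x => 'D_(unit_vec i) f x.

(* C^oo: every iterated partial derivative is continuous and again has
   partial derivatives everywhere. *)
Definition smooth phi : Prop :=
  forall s : seq 'I_2, let psi := foldr partial phi s in
    continuous psi /\ forall i x, derivable psi x (unit_vec i).

(* Membership of phi in C_c^oo of the interior of K. *)
Definition test_function K phi : Prop :=
  smooth phi /\
  exists2 C, compactly_in (interior K) C & forall x, ~ C x -> phi x = 0.

Definition L2 K f : Prop := f \_ K \in Lfun area 2%:E.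

Definition is_weak_partial K i f g : Prop :=
  L2 K g /\
  forall phi, test_function K phi ->
    \int[area]_(x in K) (f x * partial i phi x) =
    - \int[area]_(x in K) (g x * phi x).

(* An arbitrary representative; it is unique up to a null set. *)
Definition weak_partial K i f : R * R -> R :=
  xget (cst 0) [set g | is_weak_partial K i f g].

Definition H1 K f : Prop :=
  L2 K f /\ forall i, exists g, is_weak_partial K i f g.

(* In dimension two an H^2 class on a triangle has exactly one representative
   that is continuous up to the boundary; point values refer to it. *)
Definition H2 K u : Prop :=
  [/\ {within K, continuous u}, H1 K u & forall i, H1 K (weak_partial K i u)].

Definition seminorm1 K u : R :=
  Num.sqrt (\int[area]_(x in K) \sum_(i < 2) weak_partial K i u x ^+ 2).

Definition seminorm2 K u : R :=
  Num.sqrt (\int[area]_(x in K)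
    \sum_(i < 2) \sum_(j < 2) weak_partial K j (weak_partial K i u) x ^+ 2).

End Sobolev.

Section TriangleK.
Context {R : realType}.
Implicit Types alpha theta h : R.

Definition p1 : R * R := (0, 0).
Definition p2 h : R * R := (h, 0).
Definition p3 alpha theta h : R * R :=
  (alpha * h * cos theta, alpha * h * sin theta).

Definition triK alpha theta h : set (R * R) :=
  triangle p1 (p2 h) (p3 alpha theta h).

Definition hK alpha theta h : R :=
  longest_edge p1 (p2 h) (p3 alpha theta h).

Definition PiL alpha theta h (u : R * R -> R) : R * R -> R :=
  lagrange p1 (p2 h) (p3 alpha theta h) u.

(* c is a valid value of the constant C_1 for the shape (alpha, theta); it may
   not depend on the size h of the triangle. *)
Definition interpolation_constant alpha theta (c : R) : Prop :=
  forall h, 0 < h -> forall u, H2 (triK alpha theta h) u ->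
    seminorm1 (triK alpha theta h) (u \- PiL alpha theta h u)
      <= c * h * seminorm2 (triK alpha theta h) u.

End TriangleK.

(* Main.v *)
Require Import Defs.
From HB Require Import structures.
From mathcomp Require Import all_boot all_order all_algebra.
From mathcomp Require Import all_classical all_reals all_analysis.
From mathcomp Require Import measurable_realfun ring lra.
Set Implicit Arguments.
Unset Strict Implicit.
Unset Printing Implicit Defensive.
Import Order.TTheory GRing.Theory Num.Theory.
Import numFieldNormedType.Exports.
Local Open Scope classical_set_scope.
Local Open Scope ring_scope.

(** Let w be the interpolation error u - Pi u.  It vanishes at the vertex at the
    origin, so the theorem bounds the difference of the values of w at the two
    ends of the segment from the origin to x0.  Let B be the vector x0, c the
    third vertex, D twice the signed area of the subtriangle spanned by the
    origin, x0 and c, and L the longest edge.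

    Suppose first that w is smooth.  The difference of the end values is the
    integral of the tangential derivative v = B . grad w over the segment, and
    Cauchy-Schwarz bounds its square by the integral of v^2 over the segment.
    This is turned into an integral over the subtriangle by polar coordinates
    with pole c: at the point of the segment with parameter s, v^2 is
    the integral over 0 < r < 1 of d/dr (r^2 v^2) along the ray from c to that
    point, because r^2 v^2 vanishes at the pole.  Expanding the derivative, an
    inequality of Young with a free weight lam bounds it by r |B|^2 times
      (2 + L lam) |grad w|^2 + (L / lam) |hess w|^2,
    the length of the ray being at most L ([young_gradient]).  The area element
    in these coordinates is |D| r dr ds, so
      |D| (w(x0) - w(0))^2
        <= |B|^2 ((2 + L lam) |w|_1^2 + (L / lam) |w|_2^2).
    This is [difference_area].  The assumption on C1 gives |w|_1 <= C1 h |u|_2,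
    and |w|_2 = |u|_2 since Pi u is affine; lam = 1 / (C1 h) then yields
    ([optimise_weight])
      |D| w(x0)^2 <= 2 |B|^2 (C1 h L + C1^2 h^2) |u|_2^2,
    and |D| / |B| is the height of the subtriangle ([heightE]).

    For w in H^2 the computation is made on the convolution F of w with a bump
    psi(y1) psi(y2) of unit mass, supported in a small square.  A derivative of
    F may be thrown on the bump, and the reflected and translated bump is a test
    function as long as the square stays in the interior of K, so a derivative
    of F is the convolution of the weak derivative
    ([convolve_weak_partial]).  The computation therefore uses only
    differentiation under the integral sign and one-dimensional calculus along
    lines.  The pointwise bound involves squares of convolutions, which by
    Jensen are at most the convolutions of the squares ([convolve_jensen]).
    After Tonelli the integral over the rays falls on the bump alone and is at
    most 1 / |D|, by a linear change of variables ([integral_polar_kernel]);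
    hence the bound by an integral over K ([edge_area]).  To keep the squares
    inside K, the subtriangle is first shrunk by a homothety centred at the
    centroid of K ([approx_difference]); both sides of the bound scale in the
    same way.  The values of F at the shrunk end points tend to those of w
    because w is continuous up to the boundary.

    Passing from u to w changes the first weak partials by constants and leaves
    the second ones unchanged ([weak_sub_aff], [weak2_sub_aff]). *)

(** * Smooth functions of one variable and bumps *)

Section SmoothLine.
Context {R : realType}.
Implicit Types f g : R -> R.

Lemma derivable_continuous f (f' : R -> R) :
  (forall x, is_derive x (1 : R) f (f' x)) -> continuous f.
Proof.
by move=> df x; apply/differentiable_continuous/derivable1_diffP; case: (df x).
Qed.

Fixpoint nderivable (n : nat) f : Prop :=
  if n is m.+1 then exists2 f', (forall x, is_derive x (1:R) f (f' x)) & nderivable m f'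
  else True.

(** Smoothness is taken as n-fold differentiability for every n, with derivatives
    as witnesses: closure under the ring operations is then a plain induction. *)
Definition smooth1 f := forall n, nderivable n f.

Lemma nderivableW n f : nderivable n.+1 f -> nderivable n f.
Proof.
elim: n f => [//|n IH] f [f' df Cf']; exists f' => //.
exact: IH.
Qed.

Lemma nderivableD n f g : nderivable n f -> nderivable n g -> nderivable n (f \+ g).
Proof.
elim: n f g => [//|n IH] f g [f' df Cf'] [g' dg Cg'].
by exists (f' \+ g') => [x|]; [exact: is_deriveD | exact: IH].
Qed.

Lemma nderivableM n f g : nderivable n f -> nderivable n g -> nderivable n (f \* g).
Proof.
elim: n f g => [//|n IH] f g Cf Cg.
have [f' df Cf'] := Cf; have [g' dg Cg'] := Cg.
exists ((f \* g') \+ (g \* f')) => [x|].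
  exact: is_deriveM.
by apply: nderivableD; apply: IH => //; exact: nderivableW.
Qed.

Lemma nderivable_cst n (k : R) : nderivable n (cst k).
Proof.
elim: n k => [//|n IH] k; exists (cst 0) => [x|]; last exact: IH.
exact: is_derive_cst.
Qed.

Lemma is_derive_affine (a b x : R) : is_derive x (1:R) (fun t => a * t + b) a.
Proof.
by apply: is_derive_eq; rewrite /= addr0 /GRing.scale/= mulr1.
Qed.

Lemma is_derive_comp_affine f (a b x d : R) : is_derive (a * x + b) (1:R) f d ->
  is_derive x (1:R) (fun t => f (a * t + b)) (a * d).
Proof.
move=> df; have da := is_derive_affine a b x.
by rewrite mulrC; apply: is_derive1_comp.
Qed.

Lemma nderivable_affine n f (a b : R) : nderivable n f -> nderivable n (fun t => f (a * t + b)).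
Proof.
elim: n f => [//|n IH] f [f' df Cf'].
exists (cst a \* (fun t => f' (a * t + b))) => [x|].
  by apply: is_derive_comp_affine; exact: df.
by apply: nderivableM; [exact: nderivable_cst | exact: IH].
Qed.

Lemma smooth1_derive f : smooth1 f ->
  exists2 f', smooth1 f' & forall x, is_derive x (1:R) f (f' x).
Proof.
move=> sf; have [f' df _] := sf 1%N; exists f' => // n.
have [g dg] := sf n.+1; congr (nderivable n _); apply/funext => x.
by rewrite -(@derive_val _ _ _ _ _ _ _ (dg x)) (@derive_val _ _ _ _ _ _ _ (df x)).
Qed.

(** The factor t^-k makes this family closed under differentiation up to linear
    combinations, so that all derivatives are handled by one induction. *)
Definition flat_exp k (t : R) : R :=
  if 0 < t then t^-1 ^+ k * expR (- t^-1) else 0.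

(** The exponential beats the power t^-(k+2): this quadratic bound is what gives a
    vanishing derivative at the origin. *)
Lemma flat_exp_le k (t : R) : `|flat_exp k t| <= (k.+2)`!%:R * t ^+ 2.
Proof.
rewrite /flat_exp; case: ifPn => [t0|_]; last first.
  by rewrite normr0 mulr_ge0 // sqr_ge0.
rewrite ger0_norm; last by rewrite mulr_ge0 ?expR_ge0// exprn_ge0// invr_ge0 ltW.
have y0 : 0 < t^-1 by rewrite invr_gt0.
have := expR_ge1Dxn k.+1 (ltW y0).
set F := (_`!%:R); have F0 : 0 < F by rewrite ltr0n fact_gt0.
move=> le1; rewrite expRN ler_pdivrMr ?expR_gt0//.
have : t^-1 ^+ k.+2 / F <= expR t^-1 by apply: le_trans le1; rewrite lerDr.
rewrite -(ler_pM2l (_ : 0 < F * t ^+ 2)); last by rewrite mulr_gt0 ?exprn_gt0.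
apply: le_trans; rewrite le_eqVlt; apply/orP; left; apply/eqP.
rewrite !exprS; move: (t^-1 ^+ k) => q; rewrite expr0.
by field; rewrite !gt_eqF.
Qed.

Lemma is_derive_flat_exp k (x : R) :
  is_derive x (1:R) (flat_exp k) (- k%:R * flat_exp k.+1 x + flat_exp k.+2 x).
Proof.
have [x0|x0|->] := ltgtP x 0.
- apply: (@near_eq_is_derive _ _ _ (cst 0)).
    near=> y; rewrite /flat_exp ifF//; apply/negbTE; rewrite -leNgt ltW//.
    near: y; exact: lt_nbhsl.
  rewrite /flat_exp !ifF ?mulr0 ?addr0; first exact: is_derive_cst.
  - by apply/negbTE; rewrite -leNgt ltW.
  - by apply/negbTE; rewrite -leNgt ltW.
- pose g : R -> R := fun t => t^-1 ^+ k * expR (- t^-1).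
  apply: (@near_eq_is_derive _ _ _ g).
    near=> y; rewrite /flat_exp ifT//; near: y; exact: lt_nbhsr.
  have dV : is_derive x (1:R) (fun t : R => t^-1) (- x ^- 2).
    apply: is_derive_eq; first by apply: is_deriveV; rewrite gt_eqF.
    by rewrite scaler1.
  have dX := @is_deriveX _ _ _ k _ _ _ dV.
  have dE := is_derive1_comp (is_derive_expR _) (is_deriveN dV).
  have -> : g = ((fun t : R => t^-1) ^+ k) * (expR \o - (fun t : R => t^-1)).
    by apply/funext => t; rewrite /g !fctE.
  apply: is_derive_eq; rewrite /flat_exp !x0 !fctE /= opprK /GRing.scale/=.
  case: k {g dX} => [|m]; rewrite ?expr0 ?mul0r ?mulr0 ?exprS.
    by rewrite oppr0 mul0r addr0 add0r; field; rewrite gt_eqF.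
  rewrite /= expr0; move: (m.+1%:R) (_ ^+ m) (expR _) => a q e.
  by field; rewrite gt_eqF.
- have d0 : (fun h : R => h^-1 *: (flat_exp k (h *: 1 + 0) - flat_exp k 0)) @ 0^' --> (0:R).
    apply/cvgrPdist_le => e e0.
    pose M : R := (k.+2)`!%:R; have M0 : 0 < M by rewrite ltr0n fact_gt0.
    near=> h; have h0 : h != 0 by near: h; exact: nbhs_dnbhs_neq.
    rewrite sub0r normrN addr0 {2}/flat_exp ltxx subr0 normrM normfV.
    rewrite /GRing.scale/= mulr1 ler_pdivrMl ?normr_gt0//.
    apply: (le_trans (flat_exp_le _ _)); rewrite -/M -real_normK ?num_real// expr2.
    rewrite mulrCA ler_wpM2l// -ler_pdivlMl// mulrC.
    near: h; apply: dnbhs0_le; exact: divr_gt0.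
  have -> : - k%:R * flat_exp k.+1 0 + flat_exp k.+2 0 = 0 :> R.
    by rewrite /flat_exp ltxx mulr0 addr0.
  apply: DeriveDef; last exact: (cvg_lim _ d0).
  by apply/cvg_ex; exists 0.
Unshelve. all: by end_near. Qed.

Lemma smooth1_flat_exp k : smooth1 (flat_exp k).
Proof.
move=> n; elim: n k => [//|n IH] k; exists (fun x => - k%:R * flat_exp k.+1 x + flat_exp k.+2 x).
  exact: is_derive_flat_exp.
apply: (@nderivableD _ (cst (- k%:R) \* flat_exp k.+1)) => //; apply: nderivableM => //.
exact: nderivable_cst.
Qed.

Lemma smooth1M f g : smooth1 f -> smooth1 g -> smooth1 (f \* g).
Proof. by move=> sf sg n; exact: nderivableM. Qed.

Lemma smooth1_cst (c : R) : smooth1 (cst c).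
Proof. by move=> n; exact: nderivable_cst. Qed.

Lemma smooth1_affine f (a b : R) : smooth1 f -> smooth1 (fun t => f (a * t + b)).
Proof. by move=> sf n; exact: nderivable_affine. Qed.

Lemma smooth1_continuous f : smooth1 f -> continuous f.
Proof. by move=> /smooth1_derive[f' _ df]; exact: derivable_continuous df. Qed.

(** The product of the reflected translates of exp(-1/t) at -e and e is positive
    exactly between -e and e. *)
Lemma bump_exists (e : R) : 0 < e -> exists f, [/\ smooth1 f,
   forall t, 0 <= f t, forall t, e <= `|t| -> f t = 0 & 0 < f 0].
Proof.
move=> e0; exists (fun t => flat_exp 0 (1 * t + e) * flat_exp 0 (-1 * t + e)).
have F0 (t : R) : 0 <= flat_exp 0 t.
  by rewrite /flat_exp; case: ifP => // _; rewrite mulr_ge0 ?expR_ge0.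
split.
- by apply: smooth1M; apply: smooth1_affine; exact: smooth1_flat_exp.
- by move=> t; rewrite mulr_ge0.
- move=> t; rewrite ler_normr mul1r mulN1r => /orP[et|et].
    by rewrite [X in _ * X]/flat_exp ifF ?mulr0//; apply/negbTE; rewrite -leNgt; lra.
  by rewrite [X in X * _]/flat_exp ifF ?mul0r//; apply/negbTE; rewrite -leNgt; lra.
- by rewrite !mulr0 !add0r /flat_exp e0 mulr_gt0// mulr_gt0// ?expR_gt0.
Qed.
End SmoothLine.

(** * Integration in the plane *)

Section PlaneIntegration.
Context {R : realType}.
Local Notation mu := (@lebesgue_measure R).

(** An open set of the plane is the union of the countably many rational
    rectangles that it contains, hence measurable for the product sigma-algebra. *)
Lemma open_measurable2 (U : set (R * R)) : open U -> measurable U.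
Proof.
move=> oU.
pose b (q : rat * rat * (rat * rat)) : set (R * R) :=
  ball (ratr q.1.1 : R) (ratr q.1.2) `*` ball (ratr q.2.1 : R) (ratr q.2.2).
have -> : U = \bigcup_(q in [set q | b q `<=` U]) b q.
  apply/seteqP; split=> [x Ux|x [q /= bU bx]]; last exact: bU.
  have /nbhs_ballP[e /= e0 xe] : nbhs x U by apply: open_nbhs_nbhs.
  have rb (y : R) : exists c r, ball (ratr c : R) (ratr r) y /\
      ball (ratr c : R) (ratr r) `<=` ball y e.
    have [|c [r [/set_mem yb bS]]] := @open_subball_rat R (ball y e) y (ball_open _ _).
      by apply/mem_set/ballxx.
    by exists c, r.
  have [c1 [r1 [b1 s1]]] := rb x.1; have [c2 [r2 [b2 s2]]] := rb x.2.
  exists (c1, r1, (c2, r2)) => //= y [/= y1 y2]; apply: xe.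
  by split; [exact: s1 | exact: s2].
rewrite bigcup_mkcond; apply: countable_bigcupT_measurable => // q.
case: ifP => // _; apply: measurableX; exact: measurable_ball.
Qed.

Lemma continuous_measurable2 (f : R * R -> R) :
  continuous f -> measurable_fun [set: R * R] f.
Proof.
move=> cf; apply: (measurability _ (RGenOInfty.measurableE R)).
move=> _ [_ [x ->] <-]; rewrite setTI.
by apply: open_measurable2; apply: open_comp => // y _; exact: cf.
Qed.

Lemma ge0_integral_opp (G : R -> R) : continuous G -> (forall x, 0 <= G x) ->
  (\int[mu]_x (G (- x))%:E = \int[mu]_x (G x)%:E)%E.
Proof.
move=> cG G0.
transitivity (\int[pushforward mu (-%R : R -> measurableTypeR R)]_x (G x)%:E)%E.
  rewrite ge0_integral_pushforward//=.
    by apply/measurable_EFinP; exact: (continuous_measurable_fun cG).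
  by move=> x _; rewrite lee_fin.
by apply: eq_measure_integral => A mA _; exact: lebesgue_measureN.
Qed.

Lemma continuous_affine (a b : R) : continuous (fun x => a * x + b).
Proof. exact: derivable_continuous (is_derive_affine a b). Qed.

Lemma ge0_integral_affine_pos (G : R -> R) (a b : R) : continuous G ->
  (forall x, 0 <= G x) -> 0 < a ->
  (a%:E * \int[mu]_x (G (a * x + b))%:E = \int[mu]_x (G x)%:E)%E.
Proof.
move=> cG G0 a0.
pose F (x : R) := a * x + b.
have dF x : is_derive x (1 : R) F a by exact: is_derive_affine.
have F' : derive1 F = cst a.
  by apply/funext => x; rewrite derive1E; exact: derive_val.
have cF : continuous F by exact: continuous_affine.
rewrite (@increasing_ge0_integration_by_substitutionT R F G)//.
- rewrite F' -ge0_integralZl//=.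
  + by apply: eq_integral => x _; rewrite -EFinM mulrC.
  + apply/measurable_EFinP; apply: continuous_measurable_fun => x.
    by apply: continuous_comp; [exact: cF | exact: cG].
  + by move=> x _; rewrite lee_fin.
  + by rewrite lee_fin ltW.
- by move=> x y xy; rewrite /F ltrD2r ltr_pM2l.
- by rewrite F'; exact: cst_continuous.
- by rewrite F'; exact: is_cvg_cst.
- by rewrite F'; exact: is_cvg_cst.
- apply/cvgrNyPle => A; near=> x; rewrite /F.
  rewrite -lerBrDr -ler_pdivlMl//; near: x; exact: nbhs_ninfty_le.
- apply/cvgryPge => A; near=> x; rewrite /F.
  rewrite -lerBlDr -ler_pdivrMl//; near: x; exact: nbhs_pinfty_ge.
Unshelve. all: by end_near. Qed.

Lemma ge0_integral_affine (G : R -> R) (a b : R) : continuous G -> (forall x, 0 <= G x) ->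
  a != 0 -> (`|a|%:E * \int[mu]_x (G (a * x + b))%:E = \int[mu]_x (G x)%:E)%E.
Proof.
move=> cG G0; rewrite neq_lt => /orP[a0|a0]; last first.
  by rewrite gtr0_norm// ge0_integral_affine_pos.
rewrite ltr0_norm// -(@ge0_integral_affine_pos G (- a) b)// ?oppr_gt0//.
rewrite -(@ge0_integral_opp (fun x => G (- a * x + b)))//.
  by under [in RHS]eq_integral do rewrite mulrNN.
by move=> x; apply: continuous_comp; [exact: continuous_affine | exact: cG].
Qed.

Definition mollifier (e : R) (psi : R -> R) :=
  [/\ smooth1 psi, forall t, 0 <= psi t, forall t, e <= `|t| -> psi t = 0
    & (\int[mu]_x (psi x)%:E = 1)%E].

Lemma mollifier_exists (e : R) : 0 < e -> exists psi, mollifier e psi.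
Proof.
move=> e0; have [f [sf f0 fe f00]] := bump_exists e0.
have cf := smooth1_continuous sf.
have mf : measurable_fun [set: R] (EFin \o f).
  by apply/measurable_EFinP; exact: (continuous_measurable_fun cf).
have If : (\int[mu]_x (f x)%:E = \int[mu]_(x in `[(- e)%R, e]) (f x)%:E)%E.
  rewrite [RHS]integral_mkcond; apply: eq_integral => x _.
  rewrite patchE; case: ifPn => //; rewrite notin_setE/= in_itv/= => /negP xe.
  rewrite fe//; rewrite leNgt; apply/negP => /ltW.
  by rewrite ler_norml (negPf xe).
have Ifoo : (\int[mu]_x (f x)%:E < +oo)%E.
  rewrite If; have : mu.-integrable `[-e, e] (EFin \o f).
    apply: continuous_compact_integrable; first exact: segment_compact.
    exact: continuous_subspaceT.
  move=> /integrableP[_].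
  by under eq_integral do rewrite /= ger0_norm//.
have If0 : (0 < \int[mu]_x (f x)%:E)%E.
  have : \forall t \near (0 : R), f 0 / 2 < f t.
    have := cf 0; move=> /cvgr_gt; apply; lra.
  move=> /nbhs_ballP[d /= d0 df].
  pose B : set R := ball 0 d; pose c : R := f 0 / 2.
  have mB : measurable B by exact: measurable_ball.
  apply: (@lt_le_trans _ _ (\int[mu]_(x in B) c%:E)%E).
    rewrite integral_cst//=.
    rewrite lebesgue_measure_ball ?ltW// -EFinM lte_fin.
    by rewrite mulr_gt0 ?divr_gt0// mulrn_wgt0.
  apply: (@le_trans _ _ (\int[mu]_(x in B) (f x)%:E)%E).
    apply: ge0_le_integral => //=.
    - by move=> x _; rewrite lee_fin divr_ge0// ltW.
    - exact: measurable_funTS.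
    - by move=> x /df /ltW; rewrite lee_fin.
  apply: ge0_subset_integral => //=.
  by move=> x _; rewrite lee_fin.
pose I := fine (\int[mu]_x (f x)%:E)%E.
have I0 : 0 < I by rewrite fine_gt0// If0.
exists (fun t => I^-1 * f t); split.
- by apply: (@smooth1M _ (cst I^-1)) => //; exact: smooth1_cst.
- by move=> t; rewrite mulr_ge0// invr_ge0 ltW.
- by move=> t /fe ->; rewrite mulr0.
- under eq_integral do rewrite EFinM.
  rewrite ge0_integralZl//=.
  + rewrite -[X in (_ * X)%E]fineK ?ge0_fin_numE//; last exact: ltW.
    by rewrite -/I -EFinM mulVf// gt_eqF.
  + by move=> x _; rewrite lee_fin.
  + by rewrite lee_fin invr_ge0 ltW.
Qed.

Lemma continuous_affine2 (a b c : R) :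
  continuous (fun x : R * R => a * x.1 + b * x.2 + c).
Proof.
move=> x; apply: cvgD; last exact: cvg_cst.
by apply: cvgD; (apply: cvgM; first exact: cvg_cst); [exact: cvg_fst|exact: cvg_snd].
Qed.

Lemma continuous_sectl (g : R * R -> R) (r : R) :
  continuous g -> continuous (fun q => g (r, q)).
Proof.
move=> cg q; apply: (@continuous_comp _ _ _ (fun q => (r, q)) g); last exact: cg.
exact: (cvg_pair (F := nbhs q) (G := nbhs r) (H := nbhs q) (f := fun=> r) (g := id)
  (cvg_cst r) (fun A h => h)).
Qed.

Lemma continuous_sectr (g : R * R -> R) (r : R) :
  continuous g -> continuous (fun q => g (q, r)).
Proof.
move=> cg q; apply: (@continuous_comp _ _ _ (fun q => (q, r)) g); last exact: cg.
exact: (cvg_pair (F := nbhs q) (G := nbhs q) (H := nbhs r) (f := id) (g := fun=> r)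
  (fun A h => h) (cvg_cst r)).
Qed.

Lemma continuous_affine_product (psi1 psi2 : R -> R) (a1 b1 d1 a2 b2 d2 : R) :
  continuous psi1 -> continuous psi2 ->
  continuous (fun z : R * R => psi1 (a1 * z.1 + b1 * z.2 + d1) *
                               psi2 (a2 * z.1 + b2 * z.2 + d2)).
Proof.
move=> c1 c2 z; apply: cvgM.
  by apply: continuous_comp; [exact: continuous_affine2|exact: c1].
by apply: continuous_comp; [exact: continuous_affine2|exact: c2].
Qed.

(** Change of variables for the affine map with rows (A1, B1) and (A2, B2),
    reduced to the line: substituting the first row for q makes the second factor
    a function of r whose slope is the determinant divided by B1. *)
Lemma integral_affine_product_nz (psi : R -> R) (c1 A1 B1 c2 A2 B2 : R) :
  continuous psi -> (forall x, 0 <= psi x) -> (\int[mu]_x (psi x)%:E = 1)%E ->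
  B1 != 0 -> A1 * B2 - A2 * B1 != 0 ->
  (`|A1 * B2 - A2 * B1|%:E * \int[mu]_r \int[mu]_q
     (psi (A1 * r + B1 * q + c1) * psi (A2 * r + B2 * q + c2))%:E = 1)%E.
Proof.
move=> cpsi psi0 psi1 B10 D0.
pose a := A2 - A1 * (B2 / B1).
have a0 : a != 0.
  rewrite /a; apply: contra D0 => /eqP h; rewrite -oppr_eq0.
  suff -> : - (A1 * B2 - A2 * B1) = B1 * (A2 - A1 * (B2 / B1)) by rewrite h mulr0.
  by field.
have -> : `|A1 * B2 - A2 * B1| = `|B1| * `|a|.
  by rewrite -normrM -[LHS]normrN /a; congr (`|_|); field.
pose g (z : R * R) := psi (0 * z.1 + 1 * z.2 + 0) *
  psi (a * z.1 + (B2 / B1) * z.2 + (c2 - (B2 / B1) * c1)).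
have cg : continuous g by exact: continuous_affine_product.
have g0 z : 0 <= g z by rewrite mulr_ge0.
have step r : (`|B1|%:E * \int[mu]_q
     (psi (A1 * r + B1 * q + c1) * psi (A2 * r + B2 * q + c2))%:E =
     \int[mu]_q (g (r, q))%:E)%E.
  rewrite -(@ge0_integral_affine (fun q => g (r, q)) B1 (A1 * r + c1))//; last first.
    exact: continuous_sectl.
  congr (_ * _)%E; apply: eq_integral => q _; rewrite /g /=.
  by congr (psi _ * psi _)%:E; rewrite /a; field.
transitivity (`|a|%:E * \int[mu]_r \int[mu]_q (g (r, q))%:E)%E.
  under [in RHS]eq_integral do rewrite -step.
  rewrite EFinM muleAC muleC ge0_integralZl//.
  + apply: (@measurable_fun_fubini_tonelli_F _ _ _ _ _ mu (fun z : R * R =>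
      (psi (A1 * z.1 + B1 * z.2 + c1) * psi (A2 * z.1 + B2 * z.2 + c2))%:E)).
      by apply/measurable_EFinP; apply: continuous_measurable2; exact: continuous_affine_product.
    by move=> z; rewrite lee_fin mulr_ge0.
  + by move=> r _; apply: integral_ge0 => q _; rewrite lee_fin mulr_ge0.
rewrite (@fubini_tonelli _ _ _ _ _ mu mu (fun z : R * R => (g z)%:E))//=; last first.
  by apply/measurable_EFinP; exact: continuous_measurable2.
rewrite -ge0_integralZl//=; last 2 first.
  + apply: (@measurable_fun_fubini_tonelli_G _ _ _ _ _ mu (fun z : R * R => (g z)%:E)) => //.
    by apply/measurable_EFinP; exact: continuous_measurable2.
  + by move=> r _; apply: integral_ge0 => q _; rewrite lee_fin.
rewrite -psi1; apply: eq_integral => q _; rewrite /g /=.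
under eq_integral do rewrite mul0r mul1r add0r addr0 -addrA EFinM.
rewrite ge0_integralZl//=.
+ by rewrite muleCA (@ge0_integral_affine psi)// psi1 mule1.
+ apply/measurable_EFinP; apply: continuous_measurable_fun => x.
  by apply: continuous_comp; [exact: continuous_affine | exact: cpsi].
+ by move=> x _; rewrite lee_fin.
+ by rewrite lee_fin.
Qed.

Lemma integral_affine_product (psi : R -> R) (c1 A1 B1 c2 A2 B2 : R) :
  continuous psi -> (forall x, 0 <= psi x) -> (\int[mu]_x (psi x)%:E = 1)%E ->
  A1 * B2 - A2 * B1 != 0 ->
  (`|A1 * B2 - A2 * B1|%:E * \int[mu]_r \int[mu]_q
     (psi (A1 * r + B1 * q + c1) * psi (A2 * r + B2 * q + c2))%:E = 1)%E.
Proof.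
move=> cpsi psi0 psi1 D0; have [B10|B10] := eqVneq B1 0; last first.
  exact: integral_affine_product_nz.
rewrite distrC; under eq_integral do under eq_integral do rewrite mulrC.
apply: integral_affine_product_nz => //; last by rewrite -oppr_eq0 opprB.
by apply: contra D0; rewrite B10 => /eqP->; rewrite !mulr0 subrr.
Qed.
End PlaneIntegration.

(** * Integrable real functions *)

Section RealIntegrable.
Context d (T : measurableType d) {R : realType} (m : {measure set T -> \bar R}).
Variables (D : set T) (mD : measurable D).
Implicit Types f g : T -> R.

Lemma integrableRZ (c : R) f : m.-integrable D (EFin \o f) ->
  m.-integrable D (EFin \o (fun x => c * f x)).
Proof.
move=> fi; have := integrableZl mD c fi.
by apply: eq_integrable => // x _ /=; rewrite EFinM.
Qed.

Lemma integrableRD f g : m.-integrable D (EFin \o f) ->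
  m.-integrable D (EFin \o g) -> m.-integrable D (EFin \o (fun x => f x + g x)).
Proof.
move=> fi gi; have := integrableD mD fi gi.
by apply: eq_integrable => // x _ /=; rewrite EFinD.
Qed.

Lemma integrableRB f g : m.-integrable D (EFin \o f) ->
  m.-integrable D (EFin \o g) -> m.-integrable D (EFin \o (fun x => f x - g x)).
Proof.
move=> fi gi; have := integrableB mD fi gi.
by apply: eq_integrable => // x _ /=; rewrite EFinB.
Qed.
End RealIntegrable.

(** * Convolution with a product of functions of one variable *)

Section Convolution.
Context {R : realType}.
Local Notation mu := (@lebesgue_measure R).
Local Notation area := (@lebesgue_measure R \x @lebesgue_measure R)%E.

Lemma is_deriveMR (f g : R -> R) (x df dg : R) : is_derive x (1 : R) f df ->
  is_derive x (1 : R) g dg ->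
  is_derive x (1 : R) (fun t => f t * g t) (f x * dg + g x * df).
Proof. by move=> hf hg; exact: (is_deriveM hf hg). Qed.

Lemma is_deriveZR (c : R) (f : R -> R) (x df : R) : is_derive x (1 : R) f df ->
  is_derive x (1 : R) (fun t => c * f t) (c * df).
Proof. by move=> hf; exact: (is_deriveZ c hf). Qed.

Lemma smooth1_is_derive (a : R -> R) x : smooth1 a -> is_derive x (1 : R) a (derive1 a x).
Proof.
move=> /smooth1_derive[a' _ da]; apply: DeriveDef; last by rewrite derive1E.
by case: (da x).
Qed.

Lemma smooth1_derive1 (a : R -> R) : smooth1 a -> smooth1 (derive1 a).
Proof.
move=> /smooth1_derive[a' sa' da].
suff -> : derive1 a = a' by [].
by apply/funext => x; rewrite derive1E; exact: derive_val.
Qed.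

Definition csmooth (a : R -> R) :=
  smooth1 a /\ exists2 e, 0 < e & forall t, e <= `|t| -> a t = 0.

Lemma csmooth_derive1 (a : R -> R) : csmooth a -> csmooth (derive1 a).
Proof.
move=> [sa [e e0 ae]]; split; first exact: smooth1_derive1.
exists (e + 1) => [|t et]; first by rewrite addr_gt0.
rewrite derive1E (@near_eq_derive _ _ _ a (cst 0)) ?derive_cst//.
have : \forall s \near t, e < `|s|.
  have /cvgr_gt : `|s| @[s --> t] --> `|t| by apply: cvg_norm; exact: cvg_id.
  by apply; apply: lt_le_trans et; rewrite ltrDl.
by apply: filterS => s /ltW /ae.
Qed.

Lemma csmooth_bounded (a : R -> R) : csmooth a ->
  exists2 M : R, 0 <= M & forall t, `|a t| <= M.
Proof.
move=> [sa [e e0 ae]].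
have cn : {within `[- e, e], continuous (fun t => `|a t|)}.
  apply: continuous_subspaceT => t; apply: cvg_norm.
  exact: (smooth1_continuous sa).
have ee : - e <= e by lra.
have [c _ cM] := EVT_max ee cn.
exists `|a c| => // t; have [te|te] := lerP e `|t|; first by rewrite ae// normr0.
by apply: cM; rewrite in_itv/= -ler_norml ltW.
Qed.

(** The convolution of f, extended by zero outside K, with the tensor product of
    a and b. *)
Definition convolve (K : set (R * R)) (a b : R -> R) (f : R * R -> R) (x1 x2 : R) : R :=
  \int[area]_(y in K) (f y * (a (x1 - y.1) * b (x2 - y.2))).

Lemma continuous_bump_at (a b : R -> R) (x1 x2 : R) : continuous a -> continuous b ->
  continuous (fun y : R * R => a (x1 - y.1) * b (x2 - y.2)).
Proof.
move=> ca cb.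
rewrite (_ : (fun y : R * R => _) = fun z : R * R =>
  a (-1 * z.1 + 0 * z.2 + x1) * b (0 * z.1 + -1 * z.2 + x2)).
  exact: continuous_affine_product.
by apply/funext => z; congr (a _ * b _); ring.
Qed.

Lemma integrable_mul_bounded (K : set (R * R)) (f g : R * R -> R) (M : R) :
  measurable K -> area.-integrable K (EFin \o f) ->
  measurable_fun K g -> (forall y, K y -> `|g y| <= M) ->
  area.-integrable K (EFin \o (fun y => f y * g y)).
Proof.
move=> mK fi mg gM.
have := @integrableMl _ _ _ area K mK _ g fi mg.
have -> : ((EFin \o f) \* (EFin \o g))%E = EFin \o (fun y => f y * g y).
  by apply/funext => y /=; rewrite EFinM.
apply; exists M; split; first exact: num_real.
by move=> N MN y Ky /=; apply: le_trans (gM _ Ky) (ltW MN).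
Qed.

Lemma integrable_convolve (K : set (R * R)) (a b : R -> R) (f : R * R -> R) (x1 x2 : R) :
  measurable K -> area.-integrable K (EFin \o f) -> csmooth a -> csmooth b ->
  area.-integrable K (EFin \o (fun y => f y * (a (x1 - y.1) * b (x2 - y.2)))).
Proof.
move=> mK fi ca cb.
have [Ma Ma0 aM] := csmooth_bounded ca; have [Mb Mb0 bM] := csmooth_bounded cb.
apply: (@integrable_mul_bounded K f _ (Ma * Mb)) => //.
  apply: measurable_funTS; apply: continuous_measurable2.
  apply: continuous_bump_at; apply: smooth1_continuous; [exact: ca.1|exact: cb.1].
by move=> y Ky; rewrite normrM ler_pM.
Qed.

(** Along a line the convolution is differentiated under the integral sign: the
    derivative of the integrand is dominated by a multiple of |f|, since a, b and
    their derivatives are bounded. *)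
Lemma is_derive_convolve (K : set (R * R)) (a b : R -> R) (f : R * R -> R)
    (p1 d1 p2 d2 : R) (t : R) :
  measurable K -> area.-integrable K (EFin \o f) -> csmooth a -> csmooth b ->
  is_derive t (1 : R) (fun t => convolve K a b f (d1 * t + p1) (d2 * t + p2))
    (d1 * convolve K (derive1 a) b f (d1 * t + p1) (d2 * t + p2) +
     d2 * convolve K a (derive1 b) f (d1 * t + p1) (d2 * t + p2)).
Proof.
move=> mK fi ca cb; have ca' := csmooth_derive1 ca; have cb' := csmooth_derive1 cb.
have [Ma Ma0 aM] := csmooth_bounded ca; have [Mb Mb0 bM] := csmooth_bounded cb.
have [Na Na0 aN] := csmooth_bounded ca'; have [Nb Nb0 bN] := csmooth_bounded cb'.
pose k s (y : R * R) := f y * (a (d1 * s + p1 - y.1) * b (d2 * s + p2 - y.2)).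
pose k' s (y : R * R) := f y * (d1 * (derive1 a (d1 * s + p1 - y.1) * b (d2 * s + p2 - y.2))
   + d2 * (a (d1 * s + p1 - y.1) * derive1 b (d2 * s + p2 - y.2))).
have dk s y : is_derive s (1 : R) (k ^~ y) (k' s y).
  have da := is_derive_comp_affine (smooth1_is_derive (d1 * s + (p1 - y.1)) ca.1).
  have db := is_derive_comp_affine (smooth1_is_derive (d2 * s + (p2 - y.2)) cb.1).
  have -> : k ^~ y = fun s => f y * (a (d1 * s + (p1 - y.1)) * b (d2 * s + (p2 - y.2))).
    by apply/funext => r; rewrite /k -!addrA.
  apply: (is_derive_eq (is_deriveZR (f y) (is_deriveMR da db))).
  rewrite /k' -!addrA; ring.
have k'E s y : partial1of2 k s y = k' s y.
  by rewrite partial1of2E; exact: derive_val.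
have tI : `]t - 1, t + 1[%classic t by rewrite /= in_itv/=; apply/andP; split; lra.
have ki s : area.-integrable K (EFin \o k s) by exact: integrable_convolve.
pose C := `|d1| * (Na * Mb) + `|d2| * (Ma * Nb).
have Gi : area.-integrable K (EFin \o (fun y => `|f y| * C)).
  apply: (@integrable_mul_bounded K (fun y => `|f y|) (cst C) `|C|) => //.
  exact: (integrable_abse fi).
have k'G s y : `|partial1of2 k s y| <= `|f y| * C.
  rewrite k'E normrM ler_wpM2l// (le_trans (ler_normD _ _))// !normrM.
  by rewrite lerD// ler_wpM2l// ler_pM.
have G0 y : 0 <= `|f y| * C.
  by rewrite mulr_ge0// addr_ge0// mulr_ge0// mulr_ge0.
have := @cvg_differentiation_under_integral _ _ _ area k K mK t (t - 1) (t + 1) tI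
  (fun s _ => ki s) (fun s y _ _ => @ex_derive _ _ _ _ _ _ _ (dk s y))
  _ G0 Gi (fun s y _ _ => k'G s y).
have -> : \int[area]_(y in K) partial1of2 k t y =
    d1 * convolve K (derive1 a) b f (d1 * t + p1) (d2 * t + p2) +
    d2 * convolve K a (derive1 b) f (d1 * t + p1) (d2 * t + p2).
  rewrite /convolve -!RintegralZl//; [|exact: integrable_convolve..].
  rewrite -RintegralD//; last 2 first.
  - by apply: integrableRZ => //; exact: integrable_convolve.
  - by apply: integrableRZ => //; exact: integrable_convolve.
  apply: eq_Rintegral => y _; rewrite k'E /k'; ring.
move=> dF.
have {}dF : h^-1 *: (convolve K a b f (d1 * (h *: 1 + t) + p1) (d2 * (h *: 1 + t) + p2) -
    convolve K a b f (d1 * t + p1) (d2 * t + p2)) @[h --> 0^'] -->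
    d1 * convolve K (derive1 a) b f (d1 * t + p1) (d2 * t + p2) +
    d2 * convolve K a (derive1 b) f (d1 * t + p1) (d2 * t + p2).
  under eq_fun do rewrite [_ *: 1]mulr1.
  exact: dF.
apply: DeriveDef; last exact: (cvg_lim _ dF).
by apply/cvg_ex; eexists; exact: dF.
Qed.
End Convolution.

(** * Test functions and partial derivatives *)

Section TestFunctions.
Context {R : realType}.
Local Notation mu := (@lebesgue_measure R).
Local Notation area := (@lebesgue_measure R \x @lebesgue_measure R)%E.

Lemma quot_fst (f : R * R -> R) (x : R * R) :
  (fun h : R => h^-1 *: (f (h *: (1, 0) + x) - f x)) =
  (fun h : R => h^-1 *: (f (h *: (1 : R) + x.1, x.2) - f (x.1, x.2))).
Proof.
case: x => x1 x2; apply/funext => h /=; congr (_ *: (f _ - _)).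
by congr pair; rewrite /= scaler0 add0r.
Qed.

Lemma quot_snd (f : R * R -> R) (x : R * R) :
  (fun h : R => h^-1 *: (f (h *: (0, 1) + x) - f x)) =
  (fun h : R => h^-1 *: (f (x.1, h *: (1 : R) + x.2) - f (x.1, x.2))).
Proof.
case: x => x1 x2; apply/funext => h /=; congr (_ *: (f _ - _)).
by congr pair; rewrite /= scaler0 add0r.
Qed.

Lemma is_derive_fst (f : R * R -> R) (x : R * R) (d : R) :
  is_derive x.1 (1 : R) (fun s => f (s, x.2)) d <-> is_derive x ((1, 0) : R * R) f d.
Proof.
have Q := quot_fst f x.
have E1 : derivable f x ((1, 0) : R * R) = derivable (fun s => f (s, x.2)) x.1 (1 : R).
  by rewrite /derivable Q.
have E2 : 'D_((1, 0) : R * R) f x = 'D_(1 : R) (fun s => f (s, x.2)) x.1.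
  by rewrite /derive Q.
split=> -[h1 h2].
  by apply: DeriveDef; [rewrite E1 | rewrite E2].
by apply: DeriveDef; [rewrite -E1 | rewrite -E2].
Qed.

Lemma is_derive_snd (f : R * R -> R) (x : R * R) (d : R) :
  is_derive x.2 (1 : R) (fun s => f (x.1, s)) d <-> is_derive x ((0, 1) : R * R) f d.
Proof.
have Q := quot_snd f x.
have E1 : derivable f x ((0, 1) : R * R) = derivable (fun s => f (x.1, s)) x.2 (1 : R).
  by rewrite /derivable Q.
have E2 : 'D_((0, 1) : R * R) f x = 'D_(1 : R) (fun s => f (x.1, s)) x.2.
  by rewrite /derive Q.
split=> -[h1 h2].
  by apply: DeriveDef; [rewrite E1 | rewrite E2].
by apply: DeriveDef; [rewrite -E1 | rewrite -E2].
Qed.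

Definition tensor (a b : R -> R) (y : R * R) : R := a y.1 * b y.2.

Lemma is_derive_tensor (a b : R -> R) (i : 'I_2) (y : R * R) : smooth1 a -> smooth1 b ->
  is_derive y (unit_vec i : R * R) (tensor a b)
    (if i == ord0 then tensor (derive1 a) b y else tensor a (derive1 b) y).
Proof.
move=> sa sb; rewrite /unit_vec; case: ifP => _.
  apply/is_derive_fst; have := is_deriveMR (smooth1_is_derive y.1 sa)
    (@is_derive_cst _ _ _ (b y.2) y.1 1).
  by rewrite /tensor mulr0 add0r mulrC.
apply/is_derive_snd; have := is_deriveZR (a y.1) (smooth1_is_derive y.2 sb).
by [].
Qed.

Lemma partial_tensor (a b : R -> R) (i : 'I_2) : smooth1 a -> smooth1 b ->
  partial i (tensor a b) = if i == ord0 then tensor (derive1 a) b else tensor a (derive1 b).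
Proof.
move=> sa sb; apply/funext => y.
rewrite /partial (@derive_val _ _ _ _ _ _ _ (is_derive_tensor i y sa sb)).
by case: ifP.
Qed.

Lemma smooth_tensor (a b : R -> R) : smooth1 a -> smooth1 b -> smooth (tensor a b).
Proof.
move=> sa sb s /=.
have [a' [b' [sa' sb' ->]]] : exists a' b' : R -> R,
    [/\ smooth1 a', smooth1 b' & foldr partial (tensor a b) s = tensor a' b'].
  elim: s => [|i s [a' [b' [sa' sb' /= ->]]]]; first by exists a, b.
  rewrite partial_tensor//; case: ifP => _.
    by exists (derive1 a'), b'; split => //; exact: smooth1_derive1.
  by exists a', (derive1 b'); split => //; exact: smooth1_derive1.
split=> [x|i x].
  apply: cvgM; apply: continuous_comp.
  - exact: cvg_fst.
  - exact: smooth1_continuous.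
  - exact: cvg_snd.
  - exact: smooth1_continuous.
exact: @ex_derive _ _ _ _ _ _ _ (is_derive_tensor i x sa' sb').
Qed.

Definition mirror (a : R -> R) (c : R) (t : R) : R := a (c - t).

Lemma smooth1_mirror (a : R -> R) c : smooth1 a -> smooth1 (mirror a c).
Proof.
move=> /(@smooth1_affine _ _ (-1) c).
by congr smooth1; apply/funext => t; rewrite /mirror mulN1r addrC.
Qed.

Lemma derive1_mirror (a : R -> R) c : smooth1 a ->
  derive1 (mirror a c) = fun t => - derive1 a (c - t).
Proof.
move=> sa; apply/funext => t; rewrite derive1E.
have /(@derive_val _ _ _ _ _ _ _) := is_derive_comp_affine (smooth1_is_derive (-1 * t + c) sa).
rewrite [X in _ = X -> _]mulN1r [X in derive1 a X](_ : _ = c - t) => [<-|]; last first.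
  by rewrite mulN1r addrC.
have -> // : mirror a c = fun s => a (-1 * s + c).
by apply/funext => s; rewrite /mirror mulN1r addrC.
Qed.

Lemma test_function_bump (K : set (R * R)) (a b : R -> R) (e x1 x2 : R) :
  smooth1 a -> smooth1 b ->
  (forall t, e <= `|t| -> a t = 0) -> (forall t, e <= `|t| -> b t = 0) ->
  (forall y : R * R, `|x1 - y.1| <= e -> `|x2 - y.2| <= e -> (interior K) y) ->
  test_function K (tensor (mirror a x1) (mirror b x2)).
Proof.
move=> sa sb ae be box; split; first by apply: smooth_tensor; exact: smooth1_mirror.
exists (`[x1 - e, x1 + e] `*` `[x2 - e, x2 + e]).
  split.
    move=> y [/=]; rewrite !in_itv/= => /andP[h1 h2] /andP[h3 h4].
    by apply: box; rewrite ler_norml; apply/andP; split; lra.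
  by apply: compact_setX; exact: segment_compact.
move=> y /= /not_andP[] h; rewrite /tensor /mirror.
  rewrite ae ?mul0r// leNgt; apply/negP => /ltW; rewrite ler_norml => /andP[h1 h2].
  by apply: h; rewrite in_itv/=; apply/andP; split; lra.
rewrite be ?mulr0// leNgt; apply/negP => /ltW; rewrite ler_norml => /andP[h1 h2].
by apply: h; rewrite in_itv/=; apply/andP; split; lra.
Qed.

(** The derivative of a bump centred at x is, up to sign, the partial derivative
    of the test function y |-> a(x1 - y1) a(x2 - y2), so the definition of the weak
    partial applies. *)
Lemma convolve_weak_partial (K : set (R * R)) (i : 'I_2) (f g : R * R -> R)
    (a : R -> R) (e x1 x2 : R) :
  measurable K -> area.-integrable K (EFin \o f) ->
  smooth1 a -> 0 < e -> (forall t, e <= `|t| -> a t = 0) ->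
  (forall y : R * R, `|x1 - y.1| <= e -> `|x2 - y.2| <= e -> (interior K) y) ->
  is_weak_partial K i f g ->
  (if i == ord0 then convolve K (derive1 a) a f x1 x2 else convolve K a (derive1 a) f x1 x2) =
  convolve K a a g x1 x2.
Proof.
move=> mK fi sa e0 ae box [_ /(_ _ (test_function_bump sa sa ae ae box))].
rewrite partial_tensor; [|exact: smooth1_mirror..].
move=> E; apply: oppr_inj; rewrite /convolve -[RHS]E.
have ca : csmooth a by split => //; exists e.
have ca' := csmooth_derive1 ca.
case: ifP => _; rewrite -mulN1r -RintegralZl//; try exact: integrable_convolve.
  by apply: eq_Rintegral => y _; rewrite derive1_mirror// /tensor /mirror; ring.
by apply: eq_Rintegral => y _; rewrite derive1_mirror// /tensor /mirror; ring.
Qed.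

Lemma partial_eq0 (phi : R * R -> R) (C : set (R * R)) (i : 'I_2) x : closed C ->
  (forall x, ~ C x -> phi x = 0) -> ~ C x -> partial i phi x = 0.
Proof.
move=> cC phi0 Cx; rewrite /partial (@near_eq_derive _ _ _ phi (cst 0)) ?derive_cst//.
have : \forall y \near x, (~` C) y by apply: open_nbhs_nbhs; split => //; exact: closed_openC.
by apply: filterS => y /phi0.
Qed.

Lemma compact_closed2 (C : set (R * R)) : compact C -> closed C.
Proof. by apply: compact_closed; exact: norm_hausdorff. Qed.

Lemma test_function_partial (K : set (R * R)) (phi : R * R -> R) (i : 'I_2) :
  test_function K phi -> test_function K (partial i phi).
Proof.
move=> [sphi [C [CK cC] phiC]]; split.
  by move=> s; have := sphi (rcons s i); rewrite foldr_rcons.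
exists C => // x; apply: partial_eq0 => //; exact: compact_closed2.
Qed.

Lemma test_continuous (K : set (R * R)) (phi : R * R -> R) :
  test_function K phi -> continuous phi.
Proof. by move=> [sphi _]; case: (sphi [::]). Qed.

Lemma compact_bounded2 (C : set (R * R)) : compact C ->
  exists2 M : R, 0 < M & forall x, C x -> `|x.1| < M /\ `|x.2| < M.
Proof.
move=> /compact_bounded[M [_ CM]]; exists (`|M| + 2) => [|x Cx].
  by rewrite ltr_pwDr.
have : `|x| <= `|M| + 1 by apply: CM => //; rewrite ltr_pwDr// ler_norm.
rewrite /Num.norm/= ge_max => /andP[h1 h2].
by split; [apply: le_lt_trans h1 _ | apply: le_lt_trans h2 _]; rewrite ltrD2l ltr1n.
Qed.

Lemma continuous_bounded2 (C : set (R * R)) (f : R * R -> R) : compact C -> continuous f ->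
  exists2 M : R, 0 <= M & forall x, C x -> `|f x| <= M.
Proof.
move=> cC cf; have /compact_bounded[M [_ CM]] : compact (f @` C).
  by apply: continuous_compact => //; exact: continuous_subspaceT.
exists (`|M| + 1) => [|x Cx]; first by rewrite addr_ge0.
by apply: (CM (`|M| + 1)); [rewrite ltr_pwDr// ler_norm | exists x].
Qed.

Definition box (M : R) : set (R * R) := `[- M, M] `*` `[- M, M].

Lemma measurable_box M : measurable (box M).
Proof. by apply: measurableX; exact: measurable_itv. Qed.

Lemma area_box M : (area (box M) < +oo)%E.
Proof.
rewrite /box product_measure1E//= ?lebesgue_measure_itv/=.
by case: ifP => _; rewrite ?mule0 ?ltry// -EFinD -EFinM ltry.
Qed.

Lemma compact_support_integrable (f : R * R -> R) (C : set (R * R)) : compact C ->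
  continuous f -> (forall x, ~ C x -> f x = 0) ->
  area.-integrable setT (EFin \o f).
Proof.
move=> cC cf fC; have [M M0 CM] := compact_bounded2 cC.
have [N N0 fN] := continuous_bounded2 cC cf.
have fbox : EFin \o f = (EFin \o f) \_ (box M).
  apply/funext => x; rewrite patchE; case: ifPn => //; rewrite notin_setE => xM /=.
  rewrite fC// => /CM[h1 h2]; apply: xM.
  by split; rewrite /= in_itv/= -ler_norml ltW.
rewrite fbox; apply/integrable_restrict => //; first exact: measurable_box.
rewrite setTI; apply: measurable_bounded_integrable.
- exact: measurable_box.
- exact: area_box.
- by apply: measurable_funTS; exact: continuous_measurable2.
exists N; split; first exact: num_real.
move=> L NL x _ /=; have [/fN h|/fC ->] := pselect (C x); first exact: le_trans h (ltW NL).
by rewrite normr0 (le_trans N0)// ltW.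
Qed.

Lemma integral_derive (g g' : R -> R) (a b : R) : a < b ->
  (forall x, is_derive x (1 : R) g (g' x)) -> continuous g' ->
  (\int[mu]_(x in `[a, b]) (g' x)%:E = (g b - g a)%:E)%E.
Proof.
move=> ab dg cg'; have cg := derivable_continuous dg.
rewrite (@continuous_FTC2 _ g' g a b)//.
- exact: continuous_subspaceT.
- split => [x _||]; first by case: (dg x).
  + by apply: cvg_at_right_filter; exact: cg.
  + by apply: cvg_at_left_filter; exact: cg.
- by move=> x _; rewrite derive1E; exact: derive_val.
Qed.

Lemma integral_derive0 (g g' : R -> R) (M : R) : 0 < M ->
  (forall x, is_derive x (1 : R) g (g' x)) -> continuous g' ->
  (forall x, M <= `|x| -> g x = 0) -> (forall x, M <= `|x| -> g' x = 0) ->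
  (\int[mu]_x (g' x)%:E = 0)%E.
Proof.
move=> M0 dg cg' g0 g'0; have MM : - M < M by lra.
transitivity (\int[mu]_(x in `[(- M)%R, M]) (g' x)%:E)%E.
  rewrite [RHS]integral_mkcond; apply: eq_integral => x _.
  rewrite patchE; case: ifPn => //; rewrite notin_setE/= in_itv/= => /negP xe.
  rewrite g'0// leNgt; apply/negP => /ltW; rewrite ler_norml.
  by rewrite (negPf xe).
by rewrite (integral_derive MM dg cg') !g0 ?subrr// ?normrN ger0_norm// ltW.
Qed.

(** Fubini reduces this to lines, where the integral of a derivative is a
    difference of end values, both zero. *)
Lemma Rintegral_partial0 (K C : set (R * R)) (chi : R * R -> R) (i : 'I_2) :
  compact C -> C `<=` K -> (forall x, ~ C x -> chi x = 0) ->
  (forall x, derivable chi x (unit_vec i)) -> continuous (partial i chi) ->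
  \int[area]_(x in K) partial i chi x = 0.
Proof.
move=> cC CK chi0 dchi cd.
have clC := compact_closed2 cC.
have d0 x : ~ C x -> partial i chi x = 0 by exact: partial_eq0.
have [M M0 CM] := compact_bounded2 cC.
have di := compact_support_integrable cC cd d0.
rewrite Rintegral_mkcond /Rintegral.
rewrite (_ : (partial i chi) \_ K = partial i chi); last first.
  apply/funext => x; rewrite patchE; case: ifPn => //; rewrite notin_setE => xK.
  by rewrite d0// => /CK.
have out1 x1 x2 : M <= `|x1| -> ~ C (x1, x2).
  by move=> h /CM[/= /lt_geF]; rewrite h.
have out2 x1 x2 : M <= `|x2| -> ~ C (x1, x2).
  by move=> h /CM[_ /= /lt_geF]; rewrite h.
have dc x : is_derive x (unit_vec i : R * R) chi (partial i chi x) by apply: DeriveDef.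
have [i0|i1] := eqVneq i ord0.
  have u0 : unit_vec i = (1, 0) :> R * R by rewrite /unit_vec i0.
  rewrite -(integral21_prod_meas1 di) /= integral0_eq// => x2 _ /=.
  apply: (@integral_derive0 (fun s => chi (s, x2)) (fun s : R => partial i chi (s, x2)) M) => //.
  - move=> x1; apply/(is_derive_fst chi (x1, x2)).
    by rewrite -u0; exact: dc.
  - exact (@continuous_sectr R (partial i chi) x2 cd).
  - by move=> x1 h; rewrite chi0//; exact: out1.
  - by move=> x1 h; rewrite d0//; exact: out1.
have u1 : unit_vec i = (0, 1) :> R * R by rewrite /unit_vec (negPf i1).
rewrite -(integral12_prod_meas1 di) /= integral0_eq// => x1 _ /=.
apply: (@integral_derive0 (fun s => chi (x1, s)) (fun s : R => partial i chi (x1, s)) M) => //.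
- move=> x2; apply/(is_derive_snd chi (x1, x2)).
  by rewrite -u1; exact: dc.
- exact (@continuous_sectl R (partial i chi) x1 cd).
- by move=> x2 h; rewrite chi0//; exact: out2.
- by move=> x2 h; rewrite d0//; exact: out2.
Qed.

End TestFunctions.

(** * Weak partial derivatives modulo affine functions *)

Section Weak.
Context {R : realType}.
Local Notation area := (@lebesgue_measure R \x @lebesgue_measure R)%E.
Variable K : set (R * R).
Hypotheses (mK : measurable K) (fK : (area K < +oo)%E).
Implicit Types (f g u phi : R * R -> R) (i j : 'I_2).

Lemma L2_cst (c : R) : L2 K (cst c).
Proof.
have mc : measurable_fun [set: R * R] (cst c \_ K).
  by apply/(measurable_restrictT _ mK); exact: measurable_cst.
rewrite /L2 inE; apply/andP; split; rewrite inE//=.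
rewrite /finite_norm unlock poweR_lty//.
have : area.-integrable setT (EFin \o (fun x => `|(cst c \_ K) x| `^ 2)).
  have -> : EFin \o (fun x => `|(cst c \_ K) x| `^ 2) = (EFin \o cst (`|c| `^ 2)) \_ K.
    apply/funext => x /=; rewrite !patchE; case: ifP => // _.
    by rewrite normr0 powR0.
  apply/integrable_restrict => //; rewrite setTI.
  apply: measurable_bounded_integrable => //; exact: bounded_cst.
by move=> /integrable_lty; apply.
Qed.

Lemma L2B f g : L2 K f -> L2 K g -> L2 K (f \- g).
Proof.
rewrite /L2 => hf hg.
have -> : (f \- g) \_ K = f \_ K - g \_ K.
  by apply/funext => x; rewrite !fctE !patchE; case: ifP => //; rewrite subr0.
have [_ addc] : addr_closed (Lfun area (2%:E : \bar R)).
  by apply: Lfun_addr_closed; rewrite lee_fin ler1n.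
by apply: addc => //; exact: Lfun_oppr_closed.
Qed.

Lemma L2_integrable f : L2 K f -> area.-integrable K (EFin \o f).
Proof.
move=> hf; have := Lfun2_mul_Lfun1 hf (L2_cst 1).
move=> /Lfun1_integrable.
have -> : EFin \o (f \_ K \* (cst (1 : R)) \_ K) = (EFin \o f) \_ K.
  by apply/funext => x /=; rewrite !patchE; case: ifP => //=; rewrite ?mulr1 ?mulr0.
by move=> /integrable_restrict; rewrite setTI; apply.
Qed.

Lemma L2_integrable_sqr f : L2 K f -> area.-integrable K (EFin \o (fun x => f x ^+ 2)).
Proof.
move=> hf; have := Lfun2_integrable_sqr hf.
have -> : EFin \o (fun x => (f \_ K) x ^+ 2) = (EFin \o (fun x => f x ^+ 2)) \_ K.
  by apply/funext => x /=; rewrite !patchE; case: ifP => //=; rewrite expr0n.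
by move=> /integrable_restrict; rewrite setTI; apply.
Qed.

Lemma test_integrable f phi : area.-integrable K (EFin \o f) -> test_function K phi ->
  area.-integrable K (EFin \o (fun x => f x * phi x)).
Proof.
move=> fi tphi; have cphi := test_continuous tphi.
have [_ [C [CK cC] phiC]] := tphi.
have [M M0 phiM] := continuous_bounded2 cC cphi.
apply: (@integrable_mul_bounded _ K f phi M) => //.
  by apply: measurable_funTS; exact: continuous_measurable2.
by move=> y _; have [/phiM//|/phiC ->] := pselect (C y); rewrite normr0.
Qed.

Lemma cst_integrable (c : R) : area.-integrable K (EFin \o cst c).
Proof. exact: L2_integrable (L2_cst c). Qed.

Definition aff (k l m : R) (x : R * R) : R := k + l * x.1 + m * x.2.

Lemma continuous_aff k l m : continuous (aff k l m).
Proof.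
rewrite (_ : aff k l m = fun x => l * x.1 + m * x.2 + k); last first.
  by apply/funext => x; rewrite /aff; ring.
exact: continuous_affine2.
Qed.

Lemma is_derive_aff k l m i (x : R * R) :
  is_derive x (unit_vec i : R * R) (aff k l m) (if i == ord0 then l else m).
Proof.
rewrite /unit_vec; case: ifP => _.
  apply/is_derive_fst; have := is_derive_affine l (k + m * x.2) x.1.
  by rewrite (_ : (fun t => _) = fun s => aff k l m (s, x.2)) //;
    apply/funext => s; rewrite /aff /=; ring.
apply/is_derive_snd; have := is_derive_affine m (k + l * x.1) x.2.
by rewrite (_ : (fun t => _) = fun s => aff k l m (x.1, s)) //;
  apply/funext => s; rewrite /aff /=; ring.
Qed.

(** Integration by parts: the product of the affine function and phi has a
    compact support in K, so the integral of its partial derivative vanishes. *)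
Lemma weak_aff k l m i phi : area.-integrable K (EFin \o aff k l m) ->
  test_function K phi ->
  \int[area]_(x in K) (aff k l m x * partial i phi x) =
  - \int[area]_(x in K) ((if i == ord0 then l else m) * phi x).
Proof.
move=> ai tphi; set c := if _ then _ else _.
have tphi' := test_function_partial i tphi.
have [sphi [C [CK cC] phiC]] := tphi.
have dphi x : is_derive x (unit_vec i : R * R) phi (partial i phi x).
  by apply: DeriveDef => //; case: (sphi [::]).
have dchi x : is_derive x (unit_vec i : R * R) (aff k l m * phi)
    (aff k l m x * partial i phi x + c * phi x).
  by rewrite [c * _]mulrC; exact: (is_deriveM (is_derive_aff k l m i x) (dphi x)).
have pchi : partial i (aff k l m * phi) = fun x => aff k l m x * partial i phi x + c * phi x.
  by apply/funext => x; exact: (@derive_val _ _ _ _ _ _ _ (dchi x)).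
apply/eqP; rewrite -subr_eq0 opprK -RintegralD//; last 2 first.
- exact: test_integrable.
- by apply: (@test_integrable (cst c)) => //; exact: cst_integrable.
rewrite -pchi; apply/eqP; apply: (@Rintegral_partial0 _ K C) => //.
- by apply: subset_trans CK _; exact: interior_subset.
- by move=> x /phiC h; rewrite fctE h mulr0.
- rewrite pchi => x; apply: cvgD; apply: cvgM.
  + exact: continuous_aff.
  + exact: (test_continuous tphi').
  + exact: cvg_cst.
  + exact: (test_continuous tphi).
Qed.

Lemma weak_sub_aff k l m i u g :
  area.-integrable K (EFin \o aff k l m) -> area.-integrable K (EFin \o u) ->
  is_weak_partial K i u g ->
  is_weak_partial K i (u \- aff k l m) (fun x => g x - if i == ord0 then l else m).
Proof.
move=> ai ui [g2 ug]; set c := if _ then _ else _; split; first exact: L2B g2 (L2_cst c).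
move=> phi tphi; have tphi' := test_function_partial i tphi.
under eq_Rintegral do rewrite mulrBl.
rewrite RintegralB//; [|exact: test_integrable..].
rewrite ug// weak_aff// -/c.
under [in RHS]eq_Rintegral do rewrite mulrBl.
rewrite RintegralB//; first by ring.
- by apply: test_integrable => //; exact: L2_integrable.
- by apply: (@test_integrable (cst c)) => //; exact: cst_integrable.
Qed.

(** Two weak partials of f have the same pairing with every test function.  As
    the partial of a test function is again one, they have the same weak partials,
    whichever representatives are chosen. *)
Lemma weak_congr i j f g g' h : is_weak_partial K i f g -> is_weak_partial K i f g' ->
  is_weak_partial K j g h -> is_weak_partial K j g' h.
Proof.
move=> [_ fg] [_ fg'] [h2 gh]; split => // phi tphi.
have tphi' := test_function_partial j tphi.
by rewrite -gh//; apply: oppr_inj; rewrite -fg// -fg'.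
Qed.

Lemma weak_partialP i f : (exists g, is_weak_partial K i f g) ->
  is_weak_partial K i f (weak_partial K i f).
Proof. by move=> ex; exact: (xgetPex (cst 0) ex). Qed.

(** The chosen weak partial of u minus an affine function and that of u shifted by
    a constant are weak partials of the same function, so by [weak_congr] they have
    the same weak partials; and a constant does not contribute to those of the
    latter. *)
Lemma weak2_sub_aff k l m i j u :
  area.-integrable K (EFin \o aff k l m) -> area.-integrable K (EFin \o u) ->
  (exists g, is_weak_partial K i u g) ->
  (exists g, is_weak_partial K j (weak_partial K i u) g) ->
  is_weak_partial K i (u \- aff k l m) (weak_partial K i (u \- aff k l m)) /\
  is_weak_partial K j (weak_partial K i (u \- aff k l m))
    (weak_partial K j (weak_partial K i u)).
Proof.
move=> ai ui /weak_partialP ug /weak_partialP gh.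
set w := u \- aff k l m; set c := if i == ord0 then l else m.
have wG := weak_sub_aff ai ui ug.
have wG' : is_weak_partial K i w (weak_partial K i w).
  by apply: weak_partialP; eexists; exact: wG.
split; first exact: wG'.
apply: (weak_congr wG wG').
have gi : area.-integrable K (EFin \o weak_partial K i u).
  by apply: L2_integrable; case: ug.
have cE : aff c 0 0 = cst c by apply/funext => x; rewrite /aff !mul0r !addr0.
have ci : area.-integrable K (EFin \o aff c 0 0) by rewrite cE; exact: cst_integrable.
have := weak_sub_aff ci gi gh; rewrite cE.
by rewrite (_ : (fun x => _ - _) = weak_partial K j (weak_partial K i u)) //;
  apply/funext => x; rewrite if_same subr0.
Qed.

End Weak.

(** * Mollification *)

Section Smoothing.
Context {R : realType}.
Local Notation mu := (@lebesgue_measure R).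
Local Notation area := (@lebesgue_measure R \x @lebesgue_measure R)%E.
Variable K : set (R * R).
Hypotheses (mK : measurable K) (fK : (area K < +oo)%E).
Variables (e : R) (psi : R -> R).
Hypotheses (e0 : 0 < e) (mpsi : mollifier e psi).
Implicit Types (f g : R * R -> R) (i j : 'I_2).

Let spsi : smooth1 psi. Proof. by case: mpsi. Qed.
Let psi0 t : 0 <= psi t. Proof. by case: mpsi. Qed.
Let psie t : e <= `|t| -> psi t = 0. Proof. by case: mpsi => _ _ + _; apply. Qed.
Let cpsi : csmooth psi. Proof. by split => //; exists e. Qed.

(** The region where convolution with the bump commutes with weak
    differentiation: the support of the bump centred at (x1, x2) lies in the
    interior of K. *)
Definition square_inside (x1 x2 : R) :=
  forall y : R * R, `|x1 - y.1| <= e -> `|x2 - y.2| <= e -> (interior K) y.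

Lemma bump_mass x1 x2 : square_inside x1 x2 ->
  \int[area]_(y in K) (psi (x1 - y.1) * psi (x2 - y.2)) = 1.
Proof.
move=> ins; rewrite Rintegral_mkcond /Rintegral.
pose k (y : R * R) := psi (-1 * y.1 + 0 * y.2 + x1) * psi (0 * y.1 + -1 * y.2 + x2).
have ck : continuous k by apply: continuous_affine_product; exact: smooth1_continuous.
rewrite (_ : _ \_ K = k); last first.
  apply/funext => y; rewrite patchE /k !mul0r !mulN1r addr0 add0r.
  rewrite (addrC _ x1) (addrC _ x2); case: ifPn => //; rewrite notin_setE => yK.
  have [h1|h1] := leP `|x1 - y.1| e; last by rewrite psie ?mul0r// ltW.
  have [h2|h2] := leP `|x2 - y.2| e; last by rewrite [X in _ * X]psie ?mulr0// ltW.
  by exfalso; apply: yK; apply: interior_subset; exact: ins.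
rewrite fubini_tonelli1//=; last 2 first.
- by apply/measurable_EFinP; exact: continuous_measurable2.
- by move=> y; rewrite lee_fin mulr_ge0.
rewrite /fubini_F /=.
have D1 : (-1) * (-1) - 0 * 0 = 1 :> R by ring.
have psi1 : (\int[mu]_x (psi x)%:E = 1)%E by case: mpsi.
have := @integral_affine_product R psi x1 (-1) 0 x2 0 (-1) (smooth1_continuous spsi) psi0 psi1.
by rewrite D1 normr1 mul1e oner_neq0 => -> .
Qed.

Lemma Rintegral_cst_bump d x1 x2 : square_inside x1 x2 ->
  \int[area]_(y in K) (d * (psi (x1 - y.1) * psi (x2 - y.2))) = d.
Proof.
move=> ins; have ki : area.-integrable K
    (EFin \o (fun y => psi (x1 - y.1) * psi (x2 - y.2))).
  have := integrable_convolve x1 x2 mK (cst_integrable mK fK 1) cpsi cpsi.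
  by apply: eq_integrable => // y _ /=; rewrite mul1r.
by rewrite RintegralZl// bump_mass// mulr1.
Qed.

(** A convolution with a unit-mass bump is a weighted mean of the values of f on
    the square. *)
Lemma convolve_close f (c eta x1 x2 : R) : area.-integrable K (EFin \o f) -> square_inside x1 x2 ->
  (forall y : R * R, K y -> `|x1 - y.1| <= e -> `|x2 - y.2| <= e -> `|f y - c| <= eta) ->
  `|convolve K psi psi f x1 x2 - c| <= eta.
Proof.
move=> fi ins fc.
pose k (y : R * R) := psi (x1 - y.1) * psi (x2 - y.2).
have k0 y : 0 <= k y by rewrite mulr_ge0.
have icst (d : R) : area.-integrable K (EFin \o (fun y => d * k y)).
  by apply: (@integrable_convolve _ K psi psi (cst d)) => //; exact: cst_integrable.
have mass' d : \int[area]_(y in K) (d * k y) = d := Rintegral_cst_bump d ins.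
rewrite -[X in _ - X](mass' c) /convolve -RintegralB//; last exact: integrable_convolve.
have fki := integrable_convolve x1 x2 mK fi cpsi cpsi.
have fcki : area.-integrable K
    (EFin \o (fun y => f y * (psi (x1 - y.1) * psi (x2 - y.2)) - c * k y)).
  exact: integrableRB.
apply: le_trans; first by apply: le_normr_Rintegral => //; exact: fcki.
rewrite -[leRHS](mass' eta); apply: le_Rintegral => //.
  exact: (integrable_abse fcki).
move=> y Ky; rewrite -mulrBl normrM (ger0_norm (k0 y)).
have [h1|h1] := leP `|x1 - y.1| e; last by rewrite /k psie ?mul0r ?mulr0// ltW.
have [h2|h2] := leP `|x2 - y.2| e.
  by rewrite ler_wpM2r// fc.
by rewrite /k (psie (ltW h2)) !mulr0.
Qed.

(** Integrating g^2 >= 2 c g - c^2 against the bump, with c the mean of g,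
    gives the square of the mean on the left. *)
Lemma convolve_jensen g x1 x2 : L2 K g -> square_inside x1 x2 ->
  convolve K psi psi g x1 x2 ^+ 2 <= convolve K psi psi (fun y => g y ^+ 2) x1 x2.
Proof.
move=> g2 ins; set c := convolve K psi psi g x1 x2.
have gi := L2_integrable mK fK g2; have ggi := L2_integrable_sqr mK g2.
have ik f : area.-integrable K (EFin \o f) -> area.-integrable K
    (EFin \o (fun y => f y * (psi (x1 - y.1) * psi (x2 - y.2)))).
  by move=> fi; exact: integrable_convolve.
pose k (y : R * R) := psi (x1 - y.1) * psi (x2 - y.2).
have i1 := ik _ gi; have i2 := ik _ ggi.
have i3 := ik _ (cst_integrable mK fK (c ^+ 2)).
have mass' d : \int[area]_(y in K) (d * k y) = d := Rintegral_cst_bump d ins.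
have i4 : area.-integrable K
    (EFin \o (fun y => 2 * c * (g y * (psi (x1 - y.1) * psi (x2 - y.2))))).
  exact: integrableRZ.
have : 2 * c * c - c ^+ 2 <= convolve K psi psi (fun y => g y ^+ 2) x1 x2.
  rewrite -[X in _ - X](mass' (c ^+ 2)) {2}/c /convolve -RintegralZl// -RintegralB//.
  apply: le_Rintegral => //; first exact: integrableRB.
  move=> y Ky; rewrite mulrA -mulrBl ler_wpM2r ?mulr_ge0//.
  have := sqr_ge0 (g y - c); lra.
by lra.
Qed.

End Smoothing.

(** * The polar kernel *)

Section UnitSquare.
Context {R : realType}.
Local Notation mu := (@lebesgue_measure R).
Local Notation I := (`[0, 1]%classic : set R).

Lemma continuous_integrable01 (v : R -> R) : continuous v -> mu.-integrable I (EFin \o v).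
Proof.
move=> vc; apply: continuous_compact_integrable; first exact: segment_compact.
exact: continuous_subspaceT.
Qed.

Lemma Rintegral01_cst (c : R) : \int[mu]_(x in I) c = c.
Proof.
rewrite Rintegral_cst//= lebesgue_measure_itv/= lte_fin ltr01.
by rewrite -EFinB subr0 mulr1.
Qed.

Lemma continuous_sqr (v : R -> R) : continuous v -> continuous (fun x => v x ^+ 2).
Proof. by move=> hv x; rewrite /continuous_at expr2; apply: cvgM; exact: hv. Qed.

Lemma sqr_Rintegral01 (v : R -> R) : continuous v ->
  (\int[mu]_(x in I) v x) ^+ 2 <= \int[mu]_(x in I) (v x ^+ 2).
Proof.
move=> vc; set c := \int[mu]_(x in I) v x.
have vc2 := continuous_sqr vc.
have mI : measurable I by [].
have i1 := continuous_integrable01 vc; have i2 := continuous_integrable01 vc2.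
have i3 : mu.-integrable I (EFin \o (fun x => 2 * c * v x)) by exact: integrableRZ.
have i4 : mu.-integrable I (EFin \o cst (c ^+ 2)).
  by apply: continuous_integrable01; exact: cst_continuous.
have : 2 * c * c - c ^+ 2 <= \int[mu]_(x in I) (v x ^+ 2).
  rewrite -[X in _ - X]Rintegral01_cst {2}/c -RintegralZl// -RintegralB//.
  apply: le_Rintegral => //; first exact: integrableRB.
  by move=> x _; have := sqr_ge0 (v x - c); lra.
by lra.
Qed.

Section Polar.
Variables (psi : R -> R) (c1 A1 B1 c2 A2 B2 : R).
Hypotheses (cpsi : continuous psi) (psi0 : forall x, 0 <= psi x).
Hypothesis psi1 : (\int[mu]_x (psi x)%:E = 1)%E.

(** For 0 <= r, s <= 1 the point with coordinates r (A1 + s B1), r (A2 + s B2)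
    runs over a triangle with vertex at the origin; r is the distance to this
    vertex relative to the opposite edge and s the position on the edge.  The factor
    r is the Jacobian up to the determinant. *)
Definition polar_kernel (z : R * R) : R :=
  \1_I z.1 * \1_I z.2 * z.1 * (psi (c1 + z.1 * (A1 + z.2 * B1)) *
                               psi (c2 + z.1 * (A2 + z.2 * B2))).

Lemma polar_kernel_ge0 z : 0 <= polar_kernel z.
Proof.
rewrite /polar_kernel; have [z1|z1] := pselect (I z.1).
  apply: mulr_ge0; last exact: mulr_ge0.
  by rewrite !mulr_ge0//; move: z1; rewrite /= in_itv/= => /andP[].
by rewrite [\1_I z.1]indicE memNset// !mul0r.
Qed.

Lemma measurable_polar_product d (T : measurableType d) (r s d1 d2 : T -> R) :
  measurable_fun setT r -> measurable_fun setT s ->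
  measurable_fun setT d1 -> measurable_fun setT d2 ->
  measurable_fun setT (fun t => \1_I (r t) * \1_I (s t) * r t *
    (psi (d1 t + r t * (A1 + s t * B1)) * psi (d2 t + r t * (A2 + s t * B2)))).
Proof.
move=> mr ms md1 md2; have mpsi := continuous_measurable_fun cpsi.
have mI : measurable_fun setT (\1_I : R -> R) by exact: measurable_indic.
have ml (a b : R) (c : T -> R) : measurable_fun setT c ->
    measurable_fun setT (fun t => psi (c t + r t * (a + s t * b))).
  move=> mc; apply: (measurableT_comp mpsi); apply: measurable_funD => //.
  by apply: measurable_funM => //; apply: measurable_funD => //; apply: measurable_funM.
apply: measurable_funM; last by apply: measurable_funM; exact: ml.
apply: measurable_funM => //; apply: measurable_funM; exact: measurableT_comp.
Qed.

(** With q = r s the polar parametrisation becomes linear and the factor r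
    disappears; dropping the cut-offs then leaves the mass of the bump in the
    plane, divided by the determinant. *)
Lemma integral_polar_kernel : A1 * B2 - A2 * B1 != 0 ->
  (`|A1 * B2 - A2 * B1|%:E * \int[mu]_r \int[mu]_s (polar_kernel (r, s))%:E <= 1)%E.
Proof.
move=> D0; rewrite -(integral_affine_product c1 c2 cpsi psi0 psi1 D0).
pose k (z : R * R) := psi (A1 * z.1 + B1 * z.2 + c1) * psi (A2 * z.1 + B2 * z.2 + c2).
have ck : continuous k by exact: continuous_affine_product.
have k0 z : 0 <= k z by rewrite mulr_ge0.
have ik0 r : (0 <= \int[mu]_q (k (r, q))%:E)%E.
  by apply: integral_ge0 => q _; rewrite lee_fin.
apply: lee_wpmul2l; first by rewrite lee_fin.
have inner r : (\int[mu]_s (polar_kernel (r, s))%:E <= \int[mu]_q (k (r, q))%:E)%E.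
  have [rI|rI] := pselect (I r); last first.
    rewrite integral0_eq// => s _; rewrite /polar_kernel /= indicE memNset//.
    by rewrite !mul0r.
  have [->|r0] := eqVneq r 0.
    by rewrite integral0_eq// => s _; rewrite /polar_kernel /= mulr0 mul0r.
  have r00 : 0 < r.
    by move: rI; rewrite /= in_itv/= lt_neqAle eq_sym r0 => /andP[].
  have ckr : continuous (fun q => k (r, q)) by exact (@continuous_sectl R k r ck).
  have mg : measurable_fun setT (fun s : R => (k (r, r * s + 0))%:E).
    apply/measurable_EFinP; apply: continuous_measurable_fun => x.
    apply: (@continuous_comp R R R (fun s => r * s + 0) (fun q => k (r, q))).
      exact: continuous_affine.
    exact: ckr.
  rewrite -(@ge0_integral_affine_pos R (fun q => k (r, q)) r 0)//.
  rewrite -ge0_integralZl//; last 2 first.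
  - by move=> x _; rewrite lee_fin.
  - by rewrite lee_fin ltW.
  apply: ge0_le_integral => //.
  - by move=> s _; rewrite lee_fin polar_kernel_ge0.
  - apply/measurable_EFinP; rewrite /polar_kernel /=.
    by apply: (@measurable_polar_product _ _ (cst r) id (cst c1) (cst c2)).
  - exact: measurable_funeM.
  - move=> s _; rewrite -EFinM lee_fin /polar_kernel /k /=.
    rewrite (_ : A1 * r + B1 * (r * s + 0) + c1 = c1 + r * (A1 + s * B1)); last by ring.
    rewrite (_ : A2 * r + B2 * (r * s + 0) + c2 = c2 + r * (A2 + s * B2)); last by ring.
    by rewrite ler_wpM2r ?mulr_ge0// ler_piMl ?(ltW r00)//.
apply: ge0_le_integral => //.
- by move=> r _; apply: integral_ge0 => s _; rewrite lee_fin polar_kernel_ge0.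
- apply: (@measurable_fun_fubini_tonelli_F _ _ _ _ _ mu (fun z : R * R => (polar_kernel z)%:E)).
    by apply/measurable_EFinP; exact: (@measurable_polar_product _ _ fst snd (cst c1) (cst c2)).
  by move=> z; rewrite lee_fin polar_kernel_ge0.
- apply: (@measurable_fun_fubini_tonelli_F _ _ _ _ _ mu (fun z : R * R => (k z)%:E)) => //.
  by apply/measurable_EFinP; exact: continuous_measurable2.
Qed.
End Polar.
End UnitSquare.

(** * The plane as a sigma-finite measure space *)

Section PlaneMeasure.
Context {R : realType}.
Local Notation area := (@lebesgue_measure R \x @lebesgue_measure R)%E.

(** A named copy of the product measure, to carry the sigma-finite structure
    required by Tonelli on pairs of points of the plane. *)
Definition plane_measure := area.

HB.instance Definition _ := Measure.on plane_measure.

Lemma plane_measure_sigma_finite : sigma_finite setT plane_measure.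
Proof.
exists (fun n => @box R n%:R) => [|n].
  apply/seteqP; split=> // -[x y] _.
  have [n hn] : exists n : nat, Num.max `|x| `|y| <= n%:R.
    by exists (Num.bound (Num.max `|x| `|y|)); rewrite ltW// archi_boundP// le_max normr_ge0.
  by exists n => //; move: hn; rewrite ge_max !ler_norml => /andP[h1 h2]; split; rewrite /= in_itv.
split; [exact: measurable_box | exact: area_box].
Qed.

HB.instance Definition _ := Measure_isSigmaFinite.Build _ _ _ plane_measure
  plane_measure_sigma_finite.
End PlaneMeasure.

(** * A weighted inequality of Young *)

Section Young.
Context {R : realType}.

Lemma cauchy2 (a b x y : R) : (a * x + b * y) ^+ 2 <= (a ^+ 2 + b ^+ 2) * (x ^+ 2 + y ^+ 2).
Proof. have := sqr_ge0 (a * y - b * x); lra. Qed.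

Lemma young_weights_ge0 (B1 B2 L lam : R) : 0 < L -> 0 < lam ->
  0 <= (B1 ^+ 2 + B2 ^+ 2) * (2 + L * lam) /\ 0 <= (B1 ^+ 2 + B2 ^+ 2) * (L / lam).
Proof.
move=> /ltW L0 /ltW lam0; have BB0 : 0 <= B1 ^+ 2 + B2 ^+ 2 by rewrite addr_ge0 ?sqr_ge0.
by split; apply: mulr_ge0 => //; [rewrite addr_ge0// mulr_ge0 | rewrite divr_ge0].
Qed.

(** In the application a is the gradient and b the Hessian at a point of the
    ray, Y the direction of the ray and B that of the edge.  With N = B . a and
    M = B . b Y, the left side is 2 r N M + 2 N^2, where M is the rate of change of
    N along the ray; it remains to apply 2 N M <= m N^2 + M^2 / m with
    m = L lam. *)
Lemma young_gradient (B1 B2 Y1 Y2 L lam r a0 a1 b00 b01 b10 b11 : R) :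
  0 < L -> 0 < lam -> 0 <= r -> r <= 1 -> Y1 ^+ 2 + Y2 ^+ 2 <= L ^+ 2 ->
  2 * (B1 * a0 + B2 * a1) *
    (r * (B1 * (Y1 * b00 + Y2 * b01) + B2 * (Y1 * b10 + Y2 * b11)) + (B1 * a0 + B2 * a1)) <=
  (B1 ^+ 2 + B2 ^+ 2) * (2 + L * lam) * (a0 ^+ 2 + a1 ^+ 2) +
  (B1 ^+ 2 + B2 ^+ 2) * (L / lam) * (b00 ^+ 2 + b01 ^+ 2 + (b10 ^+ 2 + b11 ^+ 2)).
Proof.
move=> L0 lam0 r0 r1 YL.
set N := B1 * a0 + B2 * a1; set M := B1 * _ + B2 * _.
pose BB := B1 ^+ 2 + B2 ^+ 2; have BB0 : 0 <= BB by rewrite addr_ge0 ?sqr_ge0.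
have hN : N ^+ 2 <= BB * (a0 ^+ 2 + a1 ^+ 2) by exact: cauchy2.
have hM : M ^+ 2 <= BB * (L ^+ 2 * (b00 ^+ 2 + b01 ^+ 2 + (b10 ^+ 2 + b11 ^+ 2))).
  apply: (le_trans (cauchy2 _ _ _ _)); rewrite ler_wpM2l// mulrDr lerD//.
    apply: (le_trans (cauchy2 _ _ _ _)); rewrite ler_wpM2r//.
    by rewrite addr_ge0 ?sqr_ge0.
  apply: (le_trans (cauchy2 _ _ _ _)); rewrite ler_wpM2r//.
  by rewrite addr_ge0 ?sqr_ge0.
set Q := b00 ^+ 2 + b01 ^+ 2 + (b10 ^+ 2 + b11 ^+ 2) in hM *; set P := a0 ^+ 2 + _ in hN *.
pose m := L * lam; have m0 : 0 < m by exact: mulr_gt0.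
have hy : 2 * r * N * M <= m * N ^+ 2 + M ^+ 2 / m.
  have : 0 <= (m * N - r * M) ^+ 2 / m by rewrite divr_ge0 ?sqr_ge0// ltW.
  have -> : (m * N - r * M) ^+ 2 / m = m * N ^+ 2 - 2 * r * N * M + r ^+ 2 * (M ^+ 2 / m).
    by field; rewrite gt_eqF.
  have : r ^+ 2 * (M ^+ 2 / m) <= M ^+ 2 / m.
    by rewrite ler_piMl ?exprn_ile1// divr_ge0 ?sqr_ge0// ltW.
  lra.
have h1 : m * N ^+ 2 <= m * (BB * P) by rewrite ler_wpM2l// ltW.
have h2 : M ^+ 2 / m <= BB * (L / lam) * Q.
  rewrite ler_pdivrMr//; apply: (le_trans hM).
  rewrite le_eqVlt; apply/orP; left; apply/eqP; rewrite /m; field.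
  by rewrite gt_eqF.
have -> : BB * (2 + L * lam) * P = 2 * (BB * P) + m * (BB * P) by rewrite /m; ring.
have -> : 2 * N * (r * M + N) = 2 * r * N * M + 2 * N ^+ 2 by ring.
rewrite -/BB; lra.
Qed.
End Young.

(** * The estimate on a triangle inside the domain *)

Section Estimate.
Context {R : realType}.
Local Notation mu := (@lebesgue_measure R).
Local Notation area := (@lebesgue_measure R \x @lebesgue_measure R)%E.
Local Notation I := (`[0, 1]%classic : set R).
Variable K : set (R * R).
Hypotheses (mK : measurable K) (fK : (area K < +oo)%E).
Implicit Types (f g : R * R -> R) (i j : 'I_2).

Lemma continuous_convolve_line (a b : R -> R) f (p1 d1 p2 d2 : R) :
  area.-integrable K (EFin \o f) -> csmooth a -> csmooth b ->
  continuous (fun t => convolve K a b f (d1 * t + p1) (d2 * t + p2)).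
Proof.
by move=> fi ca cb; apply: derivable_continuous => t; exact: is_derive_convolve.
Qed.

Lemma convolveZ (a b : R -> R) (c : R) f (x1 x2 : R) :
  area.-integrable K (EFin \o f) -> csmooth a -> csmooth b ->
  convolve K a b (fun y => c * f y) x1 x2 = c * convolve K a b f x1 x2.
Proof.
move=> fi ca cb; rewrite /convolve -RintegralZl//; last exact: integrable_convolve.
by apply: eq_Rintegral => y _; rewrite -mulrA.
Qed.

Lemma convolveD (a b : R -> R) f g (x1 x2 : R) :
  area.-integrable K (EFin \o f) -> area.-integrable K (EFin \o g) ->
  csmooth a -> csmooth b ->
  convolve K a b (fun y => f y + g y) x1 x2 = convolve K a b f x1 x2 + convolve K a b g x1 x2.
Proof.
move=> fi gi ca cb; rewrite /convolve -RintegralD//; [|exact: integrable_convolve..].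
by apply: eq_Rintegral => y _; rewrite mulrDl.
Qed.

Variables (e : R) (psi : R -> R).
Hypotheses (e0 : 0 < e) (mpsi : mollifier e psi).
Let spsi : smooth1 psi. Proof. by case: mpsi. Qed.
Let psi0 t : 0 <= psi t. Proof. by case: mpsi. Qed.
Let psie t : e <= `|t| -> psi t = 0. Proof. by case: mpsi => _ _ + _; apply. Qed.
Let psi1 : (\int[mu]_x (psi x)%:E = 1)%E. Proof. by case: mpsi. Qed.
Let cpsi : csmooth psi. Proof. by split => //; exists e. Qed.
Let cdpsi : csmooth (derive1 psi). Proof. exact: csmooth_derive1. Qed.

Local Notation "f ^#" := (convolve K psi psi f) (at level 2, format "f ^#").
Local Notation i0 := (ord0 : 'I_2).
Local Notation i1 := (lift ord0 ord0 : 'I_2).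

Lemma sum_ord2 (F : 'I_2 -> R) : \sum_(i < 2) F i = F i0 + F i1.
Proof. by rewrite big_ord_recl big_ord_recl big_ord0 addr0. Qed.

Variables (w : R * R -> R) (G : 'I_2 -> R * R -> R) (g : 'I_2 -> 'I_2 -> R * R -> R).
Hypotheses (wi : area.-integrable K (EFin \o w)).
Hypotheses (wG : forall i, is_weak_partial K i w (G i)).
Hypotheses (Gg : forall i j, is_weak_partial K j (G i) (g i j)).

Let G2 i : L2 K (G i). Proof. by case: (wG i). Qed.
Let g2 i j : L2 K (g i j). Proof. by case: (Gg i j). Qed.

Definition weighted_energy (al be : R) (y : R * R) : R :=
  al * \sum_(i < 2) G i y ^+ 2 + be * \sum_(i < 2) \sum_(j < 2) g i j y ^+ 2.

Lemma weighted_energy_ge0 al be y : 0 <= al -> 0 <= be -> 0 <= weighted_energy al be y.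
Proof.
move=> al0 be0; rewrite /weighted_energy addr_ge0// mulr_ge0//.
  by apply: sumr_ge0 => i _; rewrite sqr_ge0.
by apply: sumr_ge0 => i _; apply: sumr_ge0 => j _; rewrite sqr_ge0.
Qed.

Lemma gradient_sqr_integrable :
  area.-integrable K (EFin \o (fun y => \sum_(i < 2) G i y ^+ 2)).
Proof.
have hG i := L2_integrable_sqr mK (G2 i).
have -> : (fun y => \sum_(i < 2) G i y ^+ 2) = fun y => G i0 y ^+ 2 + G i1 y ^+ 2.
  by apply/funext => y; rewrite sum_ord2.
exact: integrableRD.
Qed.

Lemma hessian_sqr_integrable :
  area.-integrable K (EFin \o (fun y => \sum_(i < 2) \sum_(j < 2) g i j y ^+ 2)).
Proof.
have hg i j := L2_integrable_sqr mK (g2 i j).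
have -> : (fun y => \sum_(i < 2) \sum_(j < 2) g i j y ^+ 2) =
  fun y => (g i0 i0 y ^+ 2 + g i0 i1 y ^+ 2) + (g i1 i0 y ^+ 2 + g i1 i1 y ^+ 2).
  by apply/funext => y; rewrite !sum_ord2.
by apply: integrableRD => //; apply: integrableRD.
Qed.

Lemma weighted_energy_integrable al be : area.-integrable K (EFin \o weighted_energy al be).
Proof.
have h1 := gradient_sqr_integrable; have h2 := hessian_sqr_integrable.
by apply: integrableRD => //; apply: integrableRZ.
Qed.

Lemma Rintegral_weighted_energy al be : \int[area]_(y in K) weighted_energy al be y =
  al * \int[area]_(y in K) (\sum_(i < 2) G i y ^+ 2) +
  be * \int[area]_(y in K) (\sum_(i < 2) \sum_(j < 2) g i j y ^+ 2).
Proof.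
have h1 := gradient_sqr_integrable; have h2 := hessian_sqr_integrable.
rewrite -!RintegralZl// -RintegralD//; exact: integrableRZ.
Qed.

Lemma weighted_energy_jensen (al be x1 x2 : R) : 0 <= al -> 0 <= be -> square_inside K e x1 x2 ->
  al * \sum_(i < 2) (G i)^# x1 x2 ^+ 2 +
    be * \sum_(i < 2) \sum_(j < 2) (g i j)^# x1 x2 ^+ 2 <= (weighted_energy al be)^# x1 x2.
Proof.
move=> al0 be0 ins.
have hG i := L2_integrable_sqr mK (G2 i); have hg i j := L2_integrable_sqr mK (g2 i j).
have jG i := convolve_jensen mK fK e0 mpsi (G2 i) ins.
have jg i j := convolve_jensen mK fK e0 mpsi (g2 i j) ins.
have -> : weighted_energy al be = fun y => al * (G i0 y ^+ 2 + G i1 y ^+ 2) +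
   be * ((g i0 i0 y ^+ 2 + g i0 i1 y ^+ 2) + (g i1 i0 y ^+ 2 + g i1 i1 y ^+ 2)).
  by apply/funext => y; rewrite /weighted_energy !sum_ord2.
have h1 : area.-integrable K (EFin \o (fun y => G i0 y ^+ 2 + G i1 y ^+ 2)).
  exact: integrableRD.
have h2 i : area.-integrable K (EFin \o (fun y => g i i0 y ^+ 2 + g i i1 y ^+ 2)).
  exact: integrableRD.
have h3 : area.-integrable K (EFin \o (fun y =>
  (g i0 i0 y ^+ 2 + g i0 i1 y ^+ 2) + (g i1 i0 y ^+ 2 + g i1 i1 y ^+ 2))).
  by apply: integrableRD => //; exact: h2.
have h4 : area.-integrable K (EFin \o (fun y => al * (G i0 y ^+ 2 + G i1 y ^+ 2))).
  exact: integrableRZ.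
have h5 : area.-integrable K (EFin \o (fun y => be *
  ((g i0 i0 y ^+ 2 + g i0 i1 y ^+ 2) + (g i1 i0 y ^+ 2 + g i1 i1 y ^+ 2)))).
  exact: integrableRZ.
rewrite (convolveD _ _ h4 h5)// (convolveZ al _ _ h1)// (convolveZ be _ _ h3)//.
rewrite (convolveD _ _ (h2 i0) (h2 i1))// !convolveD// !sum_ord2.
by rewrite lerD// ler_wpM2l// !lerD.
Qed.

Lemma convolve_gradient f (h : 'I_2 -> R * R -> R) (x1 x2 : R) :
  area.-integrable K (EFin \o f) -> (forall i, is_weak_partial K i f (h i)) ->
  square_inside K e x1 x2 ->
  convolve K (derive1 psi) psi f x1 x2 = (h i0)^# x1 x2 /\
  convolve K psi (derive1 psi) f x1 x2 = (h i1)^# x1 x2.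
Proof.
move=> fi fh ins.
by split; [have := convolve_weak_partial mK fi spsi e0 psie ins (fh i0)
          |have := convolve_weak_partial mK fi spsi e0 psie ins (fh i1)].
Qed.

(** The triangle has the vertex q and the opposite edge from q + A to q + A + B;
    X r s is its polar parametrisation with pole q, and L bounds the distance from q
    to the points of the edge. *)
Section Triangle.
Variables (q1 q2 A1 A2 B1 B2 L lam : R).
Hypotheses (L0 : 0 < L) (lam0 : 0 < lam).
Let D := A1 * B2 - A2 * B1.
Hypothesis (D0 : D != 0).
Let X1 r s := q1 + r * (A1 + s * B1).
Let X2 r s := q2 + r * (A2 + s * B2).
Hypothesis ins : forall r s, I r -> I s -> square_inside K e (X1 r s) (X2 r s).
Hypothesis AB : forall s, I s -> (A1 + s * B1) ^+ 2 + (A2 + s * B2) ^+ 2 <= L ^+ 2.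

Let T := weighted_energy ((B1 ^+ 2 + B2 ^+ 2) * (2 + L * lam)) ((B1 ^+ 2 + B2 ^+ 2) * (L / lam)).

Let Ti : area.-integrable K (EFin \o T). Proof. exact: weighted_energy_integrable. Qed.

Let Gi i : area.-integrable K (EFin \o G i). Proof. exact: L2_integrable. Qed.

Lemma continuous_ray (s : R) : continuous (fun r : R => r * T^# (X1 r s) (X2 r s)).
Proof.
rewrite (_ : (fun r => _) =
    fun r : R => r * T^# ((A1 + s * B1) * r + q1) ((A2 + s * B2) * r + q2)).
  have c : continuous (fun r => T^# ((A1 + s * B1) * r + q1) ((A2 + s * B2) * r + q2)).
    exact: continuous_convolve_line.
  by move=> r; apply: cvgM; [exact: cvg_id|exact: c].
apply/funext => r; rewrite (_ : X1 r s = (A1 + s * B1) * r + q1); last by rewrite /X1; ring.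
by rewrite (_ : X2 r s = (A2 + s * B2) * r + q2) //; rewrite /X2; ring.
Qed.

Lemma integrable_ray (s : R) :
  mu.-integrable I (EFin \o (fun r : R => r * T^# (X1 r s) (X2 r s))).
Proof.
apply: (@continuous_integrable01 R (fun r : R => r * T^# (X1 r s) (X2 r s))).
exact: continuous_ray.
Qed.

(** The function (r v)^2, with v the tangential derivative of the convolution,
    vanishes at the pole, so that its value at the edge is the integral of its
    derivative 2 r v (r v' + v).  The common factor r is the one of the polar
    kernel. *)
Lemma edge_point_le s : I s ->
  (B1 * (G i0)^# (X1 1 s) (X2 1 s) + B2 * (G i1)^# (X1 1 s) (X2 1 s)) ^+ 2 <=
  \int[mu]_(r in I) (r * T^# (X1 r s) (X2 r s)).
Proof.
move=> Is; pose Y1 := A1 + s * B1; pose Y2 := A2 + s * B2.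
have XE r : X1 r s = Y1 * r + q1 /\ X2 r s = Y2 * r + q2.
  by split; rewrite /X1 /X2 /Y1 /Y2; ring.
pose N r := B1 * (G i0)^# (Y1 * r + q1) (Y2 * r + q2) +
            B2 * (G i1)^# (Y1 * r + q1) (Y2 * r + q2).
pose d i r := Y1 * convolve K (derive1 psi) psi (G i) (Y1 * r + q1) (Y2 * r + q2) +
              Y2 * convolve K psi (derive1 psi) (G i) (Y1 * r + q1) (Y2 * r + q2).
pose N' r := B1 * d i0 r + B2 * d i1 r.
have dN r : is_derive r (1 : R) N (N' r).
  have h i := is_derive_convolve q1 Y1 q2 Y2 r mK (Gi i) cpsi cpsi.
  exact: (is_deriveD (is_deriveZR B1 (h i0)) (is_deriveZR B2 (h i1))).
have cN : continuous N := derivable_continuous dN.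
have cl a b i : csmooth a -> csmooth b ->
    continuous (fun r => convolve K a b (G i) (Y1 * r + q1) (Y2 * r + q2)).
  by move=> ca cb; exact: continuous_convolve_line.
have cd i : continuous (d i).
  have c1 := cl _ _ i cdpsi cpsi; have c2 := cl _ _ i cpsi cdpsi.
  by move=> r; apply: cvgD; (apply: cvgM; first exact: cvg_cst); [exact: c1|exact: c2].
have cN' : continuous N'.
  by move=> r; apply: cvgD; (apply: cvgM; first exact: cvg_cst); exact: cd.
(* The primitive is the square of P. *)
pose P r := r * N r; pose P' r := r * N' r + N r * 1.
have dP r : is_derive r (1 : R) P (P' r).
  exact: (is_deriveMR (is_derive_id r 1) (dN r)).
have dPP r : is_derive r (1 : R) (fun r => P r * P r) (P r * P' r + P r * P' r).
  exact: is_deriveMR.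
have cP : continuous P := derivable_continuous dP.
have cP' : continuous P'.
  move=> r; apply: cvgD; apply: cvgM; [exact: cvg_id|exact: cN'|exact: cN|exact: cvg_cst].
have cPP : continuous (fun r => P r * P' r + P r * P' r).
  by move=> r; apply: cvgD; apply: cvgM; [exact: cP|exact: cP'|exact: cP|exact: cP'].
have [E1 E2] := XE 1; rewrite E1 E2 -/(N 1).
have -> : N 1 ^+ 2 = \int[mu]_(r in I) (P r * P' r + P r * P' r).
  rewrite /Rintegral (integral_derive ltr01 dPP cPP) /= /P.
  by rewrite !mul1r !mul0r subr0 expr2.
apply: le_Rintegral => //.
- exact: continuous_integrable01.
- exact: integrable_ray.
move=> r Ir; have [F1 F2] := XE r; have insr := ins Ir Is.
have [r0 r1] : 0 <= r /\ r <= 1 by move: Ir; rewrite /= in_itv/= => /andP.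
have [al0 be0] := young_weights_ge0 B1 B2 L0 lam0.
have jen := weighted_energy_jensen al0 be0 insr; rewrite -/T in jen.
have -> : P r * P' r + P r * P' r = r * (2 * N r * (r * N' r + N r)).
  by rewrite /P /P'; ring.
rewrite ler_wpM2l//; apply: le_trans jen; rewrite !sum_ord2.
have [g00 g01] := convolve_gradient (Gi i0) (Gg i0) insr.
have [g10 g11] := convolve_gradient (Gi i1) (Gg i1) insr.
have Y2L := AB Is; rewrite -/Y1 -/Y2 in Y2L.
rewrite /N' /N /d -F1 -F2 g00 g01 g10 g11.
exact: young_gradient.
Qed.

(** Integrating the previous bound over the edge gives an integral over r, s and
    the variable y of the convolution.  Integrating in r and s first leaves the
    integral of the weighted energy against a factor that is at most 1 / |D|. *)
Lemma edge_area :
  `|D| * (w^# (X1 1 1) (X2 1 1) - w^# (X1 1 0) (X2 1 0)) ^+ 2 <= \int[area]_(y in K) T y.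
Proof.
pose F s := w^# (B1 * s + (q1 + A1)) (B2 * s + (q2 + A2)).
pose v s := B1 * convolve K (derive1 psi) psi w (B1 * s + (q1 + A1)) (B2 * s + (q2 + A2)) +
            B2 * convolve K psi (derive1 psi) w (B1 * s + (q1 + A1)) (B2 * s + (q2 + A2)).
have XE s : X1 1 s = B1 * s + (q1 + A1) /\ X2 1 s = B2 * s + (q2 + A2).
  by split; rewrite /X1 /X2; ring.
have dF s : is_derive s (1 : R) F (v s) by exact: is_derive_convolve.
have cl a b : csmooth a -> csmooth b ->
    continuous (fun s => convolve K a b w (B1 * s + (q1 + A1)) (B2 * s + (q2 + A2))).
  by move=> ca cb; exact: continuous_convolve_line.
have c1 := cl _ _ cdpsi cpsi; have c2 := cl _ _ cpsi cdpsi.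
have vc : continuous v.
  by move=> s; apply: cvgD; (apply: cvgM; first exact: cvg_cst); [exact: c1|exact: c2].
have vc2 := continuous_sqr vc.
have [-> ->] := XE 1; have [-> ->] := XE 0; rewrite -/(F 1) -/(F 0).
have -> : F 1 - F 0 = \int[mu]_(s in I) v s.
  by rewrite /Rintegral (integral_derive ltr01 dF vc).
pose TK y := (T \_ K) y.
have TK0 y : 0 <= TK y.
  rewrite /TK patchE; case: ifP => // _.
  by have [al0 be0] := young_weights_ge0 B1 B2 L0 lam0; exact: weighted_energy_ge0.
pose k (z y : R * R) := polar_kernel psi (q1 - y.1) A1 B1 (q2 - y.2) A2 B2 z.
have k0 z y : 0 <= k z y by exact: polar_kernel_ge0.
pose f (zy : (R * R) * (R * R)) := (TK zy.2 * k zy.1 zy.2)%:E.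
have f0 zy : (0 <= f zy)%E by rewrite lee_fin mulr_ge0.
have mTK : measurable_fun setT TK.
  apply/(measurable_restrictT _ mK).
  by have /integrableP[/measurable_EFinP] := Ti.
have mf : measurable_fun setT f.
  apply/measurable_EFinP; apply: measurable_funM.
    exact: (measurableT_comp mTK).
  apply: (@measurable_polar_product R psi A1 B1 A2 B2 (smooth1_continuous spsi) _ _
    (fun zy : (R * R) * (R * R) => zy.1.1) (fun zy => zy.1.2)
    (fun zy => q1 - zy.2.1) (fun zy => q2 - zy.2.2)).
  - exact: measurableT_comp.
  - exact: measurableT_comp.
  - by apply: measurable_funB => //; exact: measurableT_comp.
  - by apply: measurable_funB => //; exact: measurableT_comp.
pose H (z : R * R) := (\int[area]_y f (z, y))%E.
have H0 z : (0 <= H z)%E by apply: integral_ge0.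
have mH : measurable_fun setT H.
  exact: (@measurable_fun_fubini_tonelli_F _ _ _ _ _ (@plane_measure R) f mf f0).
have HE r s : I r -> I s -> H (r, s) = (r * T^# (X1 r s) (X2 r s))%:E.
  move=> Ir Is; rewrite /H /f /=.
  have ci := integrable_convolve (X1 r s) (X2 r s) mK Ti cpsi cpsi.
  have cri : area.-integrable K (EFin \o (fun y =>
      r * (T y * (psi (X1 r s - y.1) * psi (X2 r s - y.2))))) by exact: integrableRZ.
  rewrite /convolve -RintegralZl// /Rintegral fineK; last exact: integrable_fin_num.
  rewrite [RHS]integral_mkcond; apply: eq_integral => y _.
  rewrite /TK !patchE; case: ifP => _ /=; last by rewrite mul0r.
  rewrite /k /polar_kernel /= !indicE !mem_set// !mul1r.
  rewrite (_ : q1 - y.1 + r * (A1 + s * B1) = X1 r s - y.1); last by rewrite /X1; ring.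
  rewrite (_ : q2 - y.2 + r * (A2 + s * B2) = X2 r s - y.2); last by rewrite /X2; ring.
  by rewrite mulrCA.
have inner s : I s -> ((v s ^+ 2)%:E <= \int[mu]_r H (r, s))%E.
  move=> Is; have [F1 F2] := XE s.
  have I1 : I 1 by rewrite /= in_itv/= ler01 lexx.
  have [g0 g1] := convolve_gradient wi wG (ins I1 Is).
  have -> : v s = B1 * (G i0)^# (X1 1 s) (X2 1 s) + B2 * (G i1)^# (X1 1 s) (X2 1 s).
    by rewrite -g0 -g1 F1 F2.
  have := edge_point_le Is; rewrite -lee_fin => /le_trans; apply.
  have Ti' : mu.-integrable I (EFin \o (fun r => r * T^# (X1 r s) (X2 r s))).
    exact: integrable_ray.
  rewrite /Rintegral fineK; last exact: integrable_fin_num.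
  apply: (@le_trans _ _ (\int[mu]_(r in I) H (r, s))%E).
    rewrite le_eqVlt; apply/orP; left; apply/eqP; apply: eq_integral => r /set_mem Ir.
    by rewrite HE.
  apply: ge0_subset_integral => //.
  exact: (measurableT_comp mH).
have step : ((\int[mu]_(s in I) v s ^+ 2)%:E <= \int[area]_z H z)%E.
  rewrite (@fubini_tonelli2 _ _ _ _ _ mu mu H)// /fubini_G.
  have mG := @measurable_fun_fubini_tonelli_G _ _ _ _ _ mu H mH H0.
  rewrite /Rintegral fineK; last first.
    by apply: integrable_fin_num => //; exact: continuous_integrable01.
  apply: (@le_trans _ _ (\int[mu]_(s in I) \int[mu]_r H (r, s))%E).
    apply: ge0_le_integral => //.
    - by move=> s _; rewrite lee_fin sqr_ge0.
    - by apply/measurable_EFinP/measurable_funTS; exact: continuous_measurable_fun.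
    - by apply: measurable_funTS; exact: mG.
  apply: ge0_subset_integral => //.
  by move=> s _; exact: integral_ge0.
have swap : (\int[area]_z H z = \int[area]_y \int[area]_z f (z, y))%E.
  exact: (@fubini_tonelli _ _ _ _ _ (@plane_measure R) (@plane_measure R) f mf f0).
pose J (y : R * R) := (\int[area]_z f (z, y))%E.
have J0 y : (0 <= J y)%E by apply: integral_ge0.
have mJ : measurable_fun setT J.
  exact: (@measurable_fun_fubini_tonelli_G _ _ _ _ _ (@plane_measure R) f mf f0).
have JT y : (`|D|%:E * J y <= (TK y)%:E)%E.
  rewrite /J /f /=; under eq_integral do rewrite EFinM.
  have mk : measurable_fun setT (fun z => (k z y)%:E).
    apply/measurable_EFinP.
    exact: (@measurable_polar_product R psi A1 B1 A2 B2 (smooth1_continuous spsi) _ _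
      fst snd (cst (q1 - y.1)) (cst (q2 - y.2))).
  have k0' z : (0 <= (k z y)%:E)%E by rewrite lee_fin.
  rewrite ge0_integralZl; [|exact: measurableT|exact: mk
    |by move=> z _; exact: k0'|by rewrite lee_fin].
  rewrite muleCA -[leRHS]mule1; apply: lee_wpmul2l; first by rewrite lee_fin.
  rewrite (@fubini_tonelli1 _ _ _ _ _ mu mu (fun z => (k z y)%:E) mk k0').
  exact: integral_polar_kernel (smooth1_continuous spsi) psi0 psi1 D0.
have final : (`|D|%:E * \int[area]_y J y <= (\int[area]_(y in K) T y)%:E)%E.
  rewrite -ge0_integralZl; [|exact: measurableT|exact: mJ
    |by move=> y _; exact: J0|by rewrite lee_fin].
  rewrite /Rintegral fineK; last exact: integrable_fin_num.
  have -> : (\int[area]_(y in K) (T y)%:E = \int[area]_y (TK y)%:E)%E.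
    rewrite [LHS]integral_mkcond; apply: eq_integral => y _.
    by rewrite /TK !patchE; case: ifP.
  have mDJ : measurable_fun setT (fun y => (`|D|%:E * J y)%E) by exact: measurable_funeM.
  apply: ge0_le_integral.
  - exact: measurableT.
  - by move=> y _; apply: mule_ge0; [rewrite lee_fin|exact: J0].
  - exact: mDJ.
  - exact/measurable_EFinP.
  - by move=> y _; exact: JT.
rewrite -lee_fin EFinM; apply: le_trans final.
apply: lee_wpmul2l; first by rewrite lee_fin.
rewrite -swap; apply: le_trans step; rewrite lee_fin.
exact: sqr_Rintegral01.
Qed.

End Triangle.
End Estimate.

(** * Barycentric coordinates of a triangle *)

Section TriangleGeometry.
Context {R : realType}.
Local Notation area := (@lebesgue_measure R \x @lebesgue_measure R)%E.
Variables (h p q : R).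
Hypotheses (h0 : 0 < h) (q0 : 0 < q).
Let K : set (R * R) := triangle (0, 0) (h, 0) (p, q).

(** Indexing by all natural numbers, the third coordinate being repeated, lets
    statements quantify over the three coordinates without a bound. *)
Definition bary (m : nat) (x : R * R) : R :=
  match m with
  | 0 => 1 - (x.1 - p * (x.2 / q)) / h - x.2 / q
  | 1 => (x.1 - p * (x.2 / q)) / h
  | _ => x.2 / q
  end.

Lemma bary_aff m : exists k l n, bary m = aff k l n.
Proof.
case: m => [|[|m]].
- exists 1, (- h^-1), (p / q / h - q^-1); apply/funext => x; rewrite /aff /=.
  by field; rewrite !gt_eqF.
- exists 0, h^-1, (- (p / q / h)); apply/funext => x; rewrite /aff /=.
  by field; rewrite !gt_eqF.
- exists 0, 0, q^-1; apply/funext => x; rewrite /aff /=.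
  by field; rewrite !gt_eqF.
Qed.

Lemma bary_continuous m : continuous (bary m).
Proof. by have [k [l [n ->]]] := bary_aff m; exact: continuous_aff. Qed.

Lemma baryP x : K x <-> forall m, 0 <= bary m x.
Proof.
split=> [[r [s [t [r0 s0 t0 rst ->]]]] [|[|m]]|b0] /=.
- rewrite [X in 0 <= X](_ : _ = r) //; have -> : r = 1 - s - t by lra.
  by rewrite /GRing.scale /=; field; rewrite !gt_eqF.
- rewrite [X in 0 <= X](_ : _ = s) //.
  by rewrite /GRing.scale /=; field; rewrite !gt_eqF.
- rewrite [X in 0 <= X](_ : _ = t) //.
  by rewrite /GRing.scale /=; field; rewrite !gt_eqF.
exists (bary 0 x), (bary 1 x), (bary 2 x); split; [exact: b0..| |].
  by rewrite /=; ring.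
apply: injective_projections => /=; rewrite ![_ *: _]mulrC ?mul0r ?add0r.
  by field; rewrite !gt_eqF.
by field; rewrite !gt_eqF.
Qed.

Lemma triangle_closed : closed K.
Proof.
have -> : K = [set x | 0 <= bary 0 x] `&` [set x | 0 <= bary 1 x] `&` [set x | 0 <= bary 2 x].
  apply/seteqP; split=> x; first by move=> /baryP b; split; [split|]; exact: b.
  by move=> [[b0 b1] b2]; apply/baryP => -[|[|m]].
have c m : closed [set x | 0 <= bary m x].
  apply: (@closed_comp _ _ (bary m) [set t : R | 0 <= t]); last exact: closed_ge.
  by move=> x _; exact: (@bary_continuous m x).
by apply: closedI => //; exact: closedI.
Qed.

Lemma triangle_measurable : measurable K.
Proof.
rewrite -[K]setCK; apply: measurableC; apply: open_measurable2.
exact/closed_openC/triangle_closed.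
Qed.

Lemma triangle_bounded : exists2 M, 0 < M & forall x, K x -> `|x.1| <= M /\ `|x.2| <= M.
Proof.
exists (h + `|p| + q) => [|x [r [s [t [r0 s0 t0 rst ->]]]]].
  by rewrite addr_gt0// ltr_pwDl.
rewrite /= /GRing.scale /= !mulr0 !add0r.
have sh : s * h <= h by rewrite ler_piMl ?(ltW h0)//; lra.
have tq : t * q <= q by rewrite ler_piMl ?(ltW q0)//; lra.
have tp : t * `|p| <= `|p| by rewrite ler_piMl//; lra.
split.
  rewrite (le_trans (ler_normD _ _))// !normrM (ger0_norm s0) (ger0_norm t0) (gtr0_norm h0).
  by have := ltW q0; lra.
rewrite normrM (ger0_norm t0) (gtr0_norm q0).
by rewrite (le_trans tq)// lerDr addr_ge0// ltW.
Qed.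

Lemma triangle_finite_area : (area K < +oo)%E.
Proof.
have [M M0 KM] := triangle_bounded; apply: le_lt_trans (area_box M).
apply: le_measure; rewrite ?inE; [exact: triangle_measurable|exact: measurable_box|].
by move=> x /KM[h1 h2]; split; rewrite /= in_itv/= -ler_norml.
Qed.

Lemma triangle_interior x : (forall m, 0 < bary m x) -> (interior K) x.
Proof.
move=> b0.
have near_bary m : \forall y \near x, 0 < bary m y.
  by have /cvgr_gt := @bary_continuous m x; apply; exact: b0.
apply: filterS3 (near_bary 0%N) (near_bary 1%N) (near_bary 2%N) => y b00 b10 b20.
by apply/baryP => -[|[|m]]; exact: ltW.
Qed.

(** If all the barycentric coordinates of x exceed C e, the square of half-side e
    centred at x lies in the interior of the triangle. *)
Lemma bary_lipschitz : exists2 C : R, 0 < C & forall m (x y : R * R) e,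
  `|x.1 - y.1| <= e -> `|x.2 - y.2| <= e -> bary m x - C * e <= bary m y.
Proof.
have H m : exists2 C : R, 0 < C & forall (x y : R * R) e,
  `|x.1 - y.1| <= e -> `|x.2 - y.2| <= e -> bary m x - C * e <= bary m y.
  have [k [l [n ->]]] := bary_aff m.
  exists (`|l| + `|n| + 1) => [|x y e e1 e2]; first by rewrite ltr_pwDr// addr_ge0.
  have h1 : `|l * (x.1 - y.1)| <= `|l| * e by rewrite normrM ler_wpM2l.
  have h2 : `|n * (x.2 - y.2)| <= `|n| * e by rewrite normrM ler_wpM2l.
  have e_ge0 : 0 <= e by apply: le_trans e1.
  move: h1 h2; rewrite !ler_norml => /andP[_ h1] /andP[_ h2].
  by rewrite /aff; lra.
have [C0 C00 H0] := H 0%N; have [C1 C10 H1] := H 1%N; have [C2 C20 H2] := H 2%N.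
exists (C0 + C1 + C2) => [|m x y e e1 e2]; first by rewrite !addr_gt0.
have e_ge0 : 0 <= e by apply: le_trans e1.
have [h1 h2 h3] : [/\ 0 <= C0 * e, 0 <= C1 * e & 0 <= C2 * e].
  by split; rewrite mulr_ge0// ltW.
case: m => [|[|m]].
- by apply: le_trans (H0 x y e e1 e2); lra.
- by apply: le_trans (H1 x y e e1 e2); lra.
- by apply: le_trans (H2 x y e e1 e2); rewrite /=; lra.
Qed.

Lemma triangle_convex (t : R) x y : 0 <= t -> t <= 1 -> K x -> K y ->
  K (x.1 + t * (y.1 - x.1), x.2 + t * (y.2 - x.2)).
Proof.
move=> t0 t1 /baryP Kx /baryP Ky; apply/baryP => m.
have -> : bary m (x.1 + t * (y.1 - x.1), x.2 + t * (y.2 - x.2)) =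
    (1 - t) * bary m x + t * bary m y.
  by have [k [l [n ->]]] := bary_aff m; rewrite /aff /=; ring.
by rewrite addr_ge0// mulr_ge0// subr_ge0.
Qed.

End TriangleGeometry.

(** * Removing the mollification *)

Section ShrunkTriangle.
Context {R : realType}.
Local Notation area := (@lebesgue_measure R \x @lebesgue_measure R)%E.
Local Notation I := (`[0, 1]%classic : set R).

Lemma within_continuousP (K : set (R * R)) (w : R * R -> R) x eta :
  {within K, continuous w} -> K x -> 0 < eta -> exists2 rho, 0 < rho &
  forall y : R * R, K y -> `|x.1 - y.1| < rho -> `|x.2 - y.2| < rho -> `|w y - w x| <= eta.
Proof.
move=> /subspace_continuousP/(_ x) cw Kx eta0.
have /cvgrPdist_le/(_ _ eta0) := cw Kx.
rewrite near_withinE => /nbhs_ballP[rho /= rho0 xrho]; exists rho => // y Ky y1 y2.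
by rewrite distrC; apply: xrho.
Qed.

Variables (h p q : R).
Hypotheses (h0 : 0 < h) (q0 : 0 < q).
Let K : set (R * R) := triangle (0, 0) (h, 0) (p, q).
Let mK : measurable K. Proof. exact: triangle_measurable. Qed.
Let fK : (area K < +oo)%E. Proof. exact: triangle_finite_area. Qed.

Variables (w : R * R -> R) (G : 'I_2 -> R * R -> R) (g : 'I_2 -> 'I_2 -> R * R -> R).
Hypotheses (cw : {within K, continuous w}) (wi : area.-integrable K (EFin \o w)).
Hypotheses (wG : forall i, is_weak_partial K i w (G i)).
Hypotheses (Gg : forall i j, is_weak_partial K j (G i) (g i j)).

Variables (x : R * R) (L lam : R).
Hypotheses (Kx : K x) (D0 : q * x.1 - p * x.2 != 0) (L0 : 0 < L) (lam0 : 0 < lam).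
Hypothesis KL : forall y, K y -> (y.1 - p) ^+ 2 + (y.2 - q) ^+ 2 <= L ^+ 2.

Let Q := weighted_energy G g
  ((x.1 ^+ 2 + x.2 ^+ 2) * (2 + L * lam)) ((x.1 ^+ 2 + x.2 ^+ 2) * (L / lam)).

Let Ko : K (0, 0).
Proof. by exists 1, 0, 0; split; rewrite ?addr0// !scaler0 !scale0r !addr0. Qed.

Let Kc : K (p, q).
Proof. by exists 0, 0, 1; split; rewrite ?add0r// !scale0r !add0r scale1r. Qed.

(** The triangle is shrunk by the factor kap = 1 - del towards the centroid z.
    Since z has barycentric coordinates 1/3, those of the shrunk points are at least
    del / 3, which leaves room for squares of half-side e as soon as C e < del / 3.
    The edge vectors A and B are multiplied by kap: both the determinant and the
    weights, which are proportional to |B|^2, scale by kap^2, so the resulting bound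
    does not depend on del and e. *)
Lemma approx_difference eta : 0 < eta ->
  exists F1 F0 : R, [/\ `|F1 - w x| <= eta, `|F0 - w (0, 0)| <= eta &
    `|q * x.1 - p * x.2| * (F1 - F0) ^+ 2 <= \int[area]_(y in K) Q y].
Proof.
move=> eta0.
have [rx rx0 wx] := within_continuousP cw Kx eta0.
have [ro ro0 wo] := within_continuousP cw Ko eta0.
pose rho := Num.min rx ro; have rho0 : 0 < rho by rewrite lt_min rx0.
have [M M0 KM] := triangle_bounded p h0 q0.
have [C C0 baryC] := bary_lipschitz p h0 q0.
pose z : R * R := ((h + p) / 3, q / 3).
have bz m : bary h p q m z = 3^-1.
  by case: m => [|[|m]]; rewrite /bary /z /=; field; rewrite !gt_eqF.
have Kz : K z by apply/baryP => // m; rewrite bz invr_ge0.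
pose del := Num.min (1 / 2) (rho / (8 * M)).
have del0 : 0 < del by rewrite lt_min !divr_gt0// mulr_gt0.
have del1 : del <= 1 / 2 by rewrite ge_min lexx.
have delM : del * (2 * M) <= rho / 4.
  have : del <= rho / (8 * M) by rewrite ge_min lexx orbT.
  rewrite ler_pdivlMr ?mulr_gt0//; lra.
pose kap := 1 - del; have kap0 : 0 < kap by rewrite /kap; lra.
pose e := Num.min (rho / 4) (del / (6 * C)).
have e0 : 0 < e by rewrite lt_min !divr_gt0// mulr_gt0.
have e1 : e <= rho / 4 by rewrite ge_min lexx.
have e2 : C * e < del / 3.
  have : e <= del / (6 * C) by rewrite ge_min lexx orbT.
  rewrite ler_pdivlMr ?mulr_gt0//; lra.
have [psi mpsi] := mollifier_exists e0.
(* The pole is the image of the vertex (p, q); the edge joins the images of the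
   origin and of x. *)
pose q1 := z.1 + kap * (p - z.1); pose q2 := z.2 + kap * (q - z.2).
pose A1 := - (kap * p); pose A2 := - (kap * q).
pose B1 := kap * x.1; pose B2 := kap * x.2.
have KY r s : I r -> I s -> K (p + r * (s * x.1 - p), q + r * (s * x.2 - q)).
  rewrite /= !in_itv/= => /andP[r0 r1] /andP[s0 s1].
  have Ks := triangle_convex h0 q0 s0 s1 Ko Kx.
  have := triangle_convex h0 q0 r0 r1 Kc Ks.
  by rewrite /= !subr0 !add0r.
have X1E r s : q1 + r * (A1 + s * B1) = z.1 + kap * (p + r * (s * x.1 - p) - z.1).
  by rewrite /q1 /A1 /B1; ring.
have X2E r s : q2 + r * (A2 + s * B2) = z.2 + kap * (q + r * (s * x.2 - q) - z.2).
  by rewrite /q2 /A2 /B2; ring.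
have ins r s : I r -> I s -> square_inside K e (q1 + r * (A1 + s * B1)) (q2 + r * (A2 + s * B2)).
  move=> Ir Is y y1 y2; apply: triangle_interior => // m.
  have /(baryP p h0 q0)/(_ m) bY := KY _ _ Ir Is.
  have := baryC m (q1 + r * (A1 + s * B1), q2 + r * (A2 + s * B2)) y e y1 y2.
  apply: lt_le_trans; rewrite X1E X2E subr_gt0; apply: (lt_le_trans e2).
  set Y := (p + r * (s * x.1 - p), q + r * (s * x.2 - q)) in bY *.
  have -> : bary h p q m (z.1 + kap * (p + r * (s * x.1 - p) - z.1),
      z.2 + kap * (q + r * (s * x.2 - q) - z.2)) =
      kap * bary h p q m Y + del * bary h p q m z.
    have [k [l [n ->]]] := bary_aff p h0 q0 m.
    by rewrite /aff /Y /kap /=; ring.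
  by rewrite bz lerDr mulr_ge0// ltW.
have AB s : I s -> (A1 + s * B1) ^+ 2 + (A2 + s * B2) ^+ 2 <= L ^+ 2.
  move=> Is; have I1 : I 1 by rewrite /= in_itv/= ler01 lexx.
  have := KL (KY _ _ I1 Is); apply: le_trans => /=.
  have -> : (A1 + s * B1) ^+ 2 + (A2 + s * B2) ^+ 2 = kap ^+ 2 *
    ((p + 1 * (s * x.1 - p) - p) ^+ 2 + (q + 1 * (s * x.2 - q) - q) ^+ 2).
    by rewrite /A1 /A2 /B1 /B2; ring.
  rewrite ler_piMl ?addr_ge0 ?sqr_ge0// exprn_ile1 ?(ltW kap0)//.
  by rewrite /kap; lra.
have D0' : A1 * B2 - A2 * B1 != 0.
  have -> : A1 * B2 - A2 * B1 = kap ^+ 2 * (q * x.1 - p * x.2).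
    by rewrite /A1 /A2 /B1 /B2; ring.
  by rewrite mulf_neq0// expf_neq0// gt_eqF.
have := edge_area mK fK e0 mpsi wi wG Gg L0 lam0 D0' ins AB.
rewrite /= => le1.
have near_P (c d P : R) : `|P| <= M -> `|c| <= M ->
    `|c + kap * (P - c) - d| <= e -> `|P - d| < rho.
  move=> PM cM cd.
  have -> : P - d = del * (P - c) + (c + kap * (P - c) - d) by rewrite /kap; ring.
  apply: (le_lt_trans (ler_normD _ _)).
  have : `|del * (P - c)| <= rho / 4.
    apply: le_trans delM; rewrite normrM (gtr0_norm del0) ler_wpM2l ?(ltW del0)//.
    by apply: (le_trans (ler_normB _ _)); lra.
  lra.
have [z1M z2M] := KM z Kz.
have [x1M x2M] := KM x Kx.
have [p1M p2M] := KM _ Ko.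
have I1 : I 1 by rewrite /= in_itv/= ler01 lexx.
have I0 : I 0 by rewrite /= in_itv/= ler01 lexx.
have E11 : q1 + 1 * (A1 + 1 * B1) = z.1 + kap * (x.1 - z.1) by rewrite /q1 /A1 /B1; ring.
have E12 : q2 + 1 * (A2 + 1 * B2) = z.2 + kap * (x.2 - z.2) by rewrite /q2 /A2 /B2; ring.
have E01 : q1 + 1 * (A1 + 0 * B1) = z.1 + kap * (0 - z.1) by rewrite /q1 /A1 /B1; ring.
have E02 : q2 + 1 * (A2 + 0 * B2) = z.2 + kap * (0 - z.2) by rewrite /q2 /A2 /B2; ring.
have in1 := ins _ _ I1 I1; have in0 := ins _ _ I1 I0.
rewrite E11 E12 in in1 le1; rewrite E01 E02 in in0 le1.
exists (convolve K psi psi w (z.1 + kap * (x.1 - z.1)) (z.2 + kap * (x.2 - z.2))),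
  (convolve K psi psi w (z.1 + kap * (0 - z.1)) (z.2 + kap * (0 - z.2))); split.
- apply: (convolve_close mK fK e0 mpsi) => // y Ky y1 y2; apply: wx => //.
    by apply: (@lt_le_trans _ _ rho); [exact: near_P y1 | rewrite ge_min lexx].
  by apply: (@lt_le_trans _ _ rho); [exact: near_P y2 | rewrite ge_min lexx].
- apply: (convolve_close mK fK e0 mpsi) => // y Ky y1 y2; apply: wo => //.
    by apply: (@lt_le_trans _ _ rho); [exact: near_P y1 | rewrite ge_min lexx orbT].
  by apply: (@lt_le_trans _ _ rho); [exact: near_P y2 | rewrite ge_min lexx orbT].
have Qi := weighted_energy_integrable mK wG Gg ((x.1 ^+ 2 + x.2 ^+ 2) * (2 + L * lam))
    ((x.1 ^+ 2 + x.2 ^+ 2) * (L / lam)).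
rewrite -(ler_pM2l (_ : 0 < kap ^+ 2)); last by rewrite exprn_gt0.
have <- : \int[area]_(y in K) (kap ^+ 2 * Q y) = kap ^+ 2 * \int[area]_(y in K) Q y.
  by rewrite RintegralZl.
rewrite mulrA; move: le1.
have -> : `|A1 * B2 - A2 * B1| = kap ^+ 2 * `|q * x.1 - p * x.2|.
  rewrite -[kap ^+ 2]ger0_norm ?sqr_ge0// -normrM; congr (`|_|).
  by rewrite /A1 /A2 /B1 /B2; ring.
move=> /le_trans; apply; rewrite le_eqVlt; apply/orP; left; apply/eqP.
by apply: eq_Rintegral => y _; rewrite /Q /weighted_energy /B1 /B2; ring.
Qed.

(** The bound of the approximations is uniform, so it passes to the limit. *)
Lemma difference_area :
  `|q * x.1 - p * x.2| * (w x - w (0, 0)) ^+ 2 <= \int[area]_(y in K) Q y.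
Proof.
have Dp : 0 < `|q * x.1 - p * x.2| by rewrite normr_gt0.
rewrite mulrC -ler_pdivlMr//; set V := _ / _.
have V0 : 0 <= V.
  have [al0 be0] := young_weights_ge0 x.1 x.2 L0 lam0.
  by rewrite divr_ge0//; apply: Rintegral_ge0 => y _; exact: weighted_energy_ge0.
suff : `|w x - w (0, 0)| <= Num.sqrt V.
  by rewrite -(ler_sqr (normr_ge0 _)) ?nnegrE ?sqrtr_ge0// sqr_sqrtr// real_normK ?num_real.
apply/ler_addgt0Pr => eta eta0.
have eta2 : 0 < eta / 2 by rewrite divr_gt0.
have [F1 [F0 [h1 h2 h3]]] := approx_difference eta2.
have : `|F1 - F0| <= Num.sqrt V.
  rewrite -(ler_sqr (normr_ge0 _)) ?nnegrE ?sqrtr_ge0// sqr_sqrtr// real_normK ?num_real//.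
  by rewrite ler_pdivlMr// mulrC.
have -> : w x - w (0, 0) = (F1 - F0) - (F1 - w x) + (F0 - w (0, 0)) by ring.
move=> h4; apply: (le_trans (ler_normD _ _)).
apply: (@le_trans _ _ (`|F1 - F0| + `|F1 - w x| + `|F0 - w (0, 0)|)).
  by rewrite lerD2r ler_normB.
lra.
Qed.

End ShrunkTriangle.

(** * From the area bound to the height *)

Section Final.
Context {R : realType}.

(** The weight lam = 1 / c is the best choice once a is replaced by its bound
    c b.  If b = 0 or c = 0 then a = 0, and the claim follows with any lam or in the
    limit of large lam. *)
Lemma optimise_weight (D BB L a b W c : R) : 0 <= BB -> 0 < L -> 0 <= a -> 0 <= b ->
  a <= c * b ->
  (forall lam, 0 < lam -> D * W ^+ 2 <= BB * (2 + L * lam) * a ^+ 2 + BB * (L / lam) * b ^+ 2) ->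
  D * W ^+ 2 <= 2 * BB * (c * L + c ^+ 2) * b ^+ 2.
Proof.
move=> BB0 L0 a0; rewrite le_eqVlt => /orP[/eqP<-|b0] acb DW.
  have a00 : a = 0 by apply/eqP; rewrite eq_le a0 andbT (le_trans acb)// mulr0.
  by have := DW 1 ltr01; rewrite a00 !expr0n /= !mulr0 addr0.
have : 0 <= c by rewrite -(pmulr_lge0 _ b0) (le_trans a0).
rewrite le_eqVlt => /orP[/eqP c0|c0]; last first.
  have cV : 0 < c^-1 by rewrite invr_gt0.
  apply: (le_trans (DW _ cV)); rewrite invrK.
  have a2 : a ^+ 2 <= (c * b) ^+ 2 by rewrite ler_sqr ?nnegrE// mulr_ge0// ltW.
  have : BB * (2 + L / c) * a ^+ 2 <= BB * (2 + L / c) * (c * b) ^+ 2.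
    by rewrite ler_wpM2l// mulr_ge0// addr_ge0// divr_ge0// ltW.
  have -> : BB * (2 + L / c) * (c * b) ^+ 2 = BB * (2 * c ^+ 2 + L * c) * b ^+ 2.
    by field; rewrite gt_eqF.
  lra.
have a00 : a = 0 by apply/eqP; rewrite eq_le a0 andbT (le_trans acb)// -c0 mul0r.
rewrite -c0 mul0r expr0n /= addr0 mulr0 mul0r.
apply/ler_addgt0Pr => eta eta0; rewrite add0r.
pose N := BB * L * b ^+ 2; have N0 : 0 <= N by rewrite mulr_ge0 ?sqr_ge0// mulr_ge0// ltW.
have lam0 : 0 < (N + 1) / eta by rewrite divr_gt0// ltr_pwDr.
have := DW _ lam0; rewrite a00 expr0n /= mulr0 add0r => /le_trans; apply.
have -> : BB * (L / ((N + 1) / eta)) * b ^+ 2 = eta * (N / (N + 1)).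
  by rewrite {2}/N; field; rewrite !gt_eqF// ltr_pwDr.
by rewrite ler_piMr ?(ltW eta0)// ler_pdivrMr ?ltr_pwDr// mul1r lerDl.
Qed.

(** With y = r (0, 0) + s (h, 0) + t (p, q), the squared distance to (p, q) is a
    convex combination of squared edge lengths, up to the factor r + s <= 1 and a
    nonpositive term. *)
Lemma triangle_radius (h p q : R) (y : R * R) :
  triangle (0, 0) (h, 0) (p, q) y ->
  (y.1 - p) ^+ 2 + (y.2 - q) ^+ 2 <= longest_edge (0, 0) (h, 0) (p, q) ^+ 2.
Proof.
move=> [r [s [t [r0 s0 t0 rst ->]]]]; set H := longest_edge _ _ _.
have H0 : 0 <= H by rewrite le_max sqrtr_ge0.
have sqH (a b : R * R) : dist a b <= H -> (b.1 - a.1) ^+ 2 + (b.2 - a.2) ^+ 2 <= H ^+ 2.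
  move=> abH; have : dist a b ^+ 2 <= H ^+ 2 by rewrite ler_sqr ?nnegrE ?sqrtr_ge0.
  by rewrite sqr_sqrtr /dot /= -?expr2// addr_ge0 ?sqr_ge0.
have hU : p ^+ 2 + q ^+ 2 <= H ^+ 2.
  have := @sqH (p, q) (0, 0); rewrite /= !sub0r !sqrrN; apply.
  by rewrite /H /longest_edge !le_max lexx !orbT.
have hV : (p - h) ^+ 2 + q ^+ 2 <= H ^+ 2.
  have := @sqH (h, 0) (p, q); rewrite /= subr0; apply.
  by rewrite /H /longest_edge !le_max lexx !orbT.
have -> : t = 1 - r - s by lra.
rewrite /= ![_ *: _]mulrC.
have -> : (0 * r + h * s + p * (1 - r - s) - p) ^+ 2 + (0 * r + 0 * s + q * (1 - r - s) - q) ^+ 2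
  = (r + s) * (r * (p ^+ 2 + q ^+ 2) + s * ((p - h) ^+ 2 + q ^+ 2)) - r * s * h ^+ 2 by ring.
have rs0 : 0 <= r * s * h ^+ 2 by rewrite mulr_ge0 ?sqr_ge0// mulr_ge0.
have h1 : r * (p ^+ 2 + q ^+ 2) + s * ((p - h) ^+ 2 + q ^+ 2) <= (r + s) * H ^+ 2.
  by rewrite mulrDl lerD// ler_wpM2l.
have rs1 : 0 <= r + s <= 1 by apply/andP; split; lra.
have [rs2 rs3] := andP rs1.
have h2 : (r + s) * (r * (p ^+ 2 + q ^+ 2) + s * ((p - h) ^+ 2 + q ^+ 2)) <=
    (r + s) * ((r + s) * H ^+ 2).
  by rewrite ler_wpM2l.
have h3 : (r + s) * ((r + s) * H ^+ 2) <= H ^+ 2.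
  by rewrite mulrA ler_piMl ?sqr_ge0// mulr_ile1.
lra.
Qed.

Lemma heightE (x c : R * R) : x.1 ^+ 2 + x.2 ^+ 2 != 0 ->
  height (0, 0) x c = `|c.2 * x.1 - c.1 * x.2| / Num.sqrt (x.1 ^+ 2 + x.2 ^+ 2).
Proof.
move=> BB0; have BBp : 0 < x.1 ^+ 2 + x.2 ^+ 2.
  by rewrite lt_neqAle eq_sym BB0 addr_ge0 ?sqr_ge0.
rewrite /height /dist.
have -> : dot (foot (0, 0) x c - c) (foot (0, 0) x c - c) =
    (`|c.2 * x.1 - c.1 * x.2| / Num.sqrt (x.1 ^+ 2 + x.2 ^+ 2)) ^+ 2.
  rewrite expr_div_n sqr_sqrtr ?ltW// real_normK ?num_real//.
  case: x c BB0 {BBp} => x1 x2 [c1 c2] /= BB0.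
  rewrite /foot /dot /= /GRing.scale /= !subr0 !add0r.
  by field.
by rewrite sqrtr_sqr ger0_norm// divr_ge0// sqrtr_ge0.
Qed.

Lemma dist0E (x : R * R) : dist (0, 0) x = Num.sqrt (x.1 ^+ 2 + x.2 ^+ 2).
Proof. by rewrite /dist /dot /= !subr0 -!expr2. Qed.

(** When b = 0 nothing is known about the sign of Z; the bound then reads W = 0,
    and the value of its square root is irrelevant. *)
Lemma sqrt_estimate (D BB Z b W : R) : 0 < D -> 0 < BB -> 0 <= b ->
  0 <= Z \/ b = 0 ->
  D * W ^+ 2 <= 2 * BB * Z * b ^+ 2 ->
  `|W| <= Num.sqrt (2 * Num.sqrt BB) / Num.sqrt (D / Num.sqrt BB) * Num.sqrt Z * b.
Proof.
move=> D0 BB0 b0 Zb le1.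
have S0 : 0 < Num.sqrt BB by rewrite sqrtr_gt0.
have rhs0 : 0 <= Num.sqrt (2 * Num.sqrt BB) / Num.sqrt (D / Num.sqrt BB) * Num.sqrt Z * b.
  by rewrite !mulr_ge0 ?invr_ge0 ?sqrtr_ge0.
rewrite -(ler_sqr (normr_ge0 _)) ?nnegrE// real_normK ?num_real//.
rewrite !exprMn exprVn [Num.sqrt (2 * _) ^+ 2]sqr_sqrtr; last by rewrite mulr_ge0// ltW.
rewrite [Num.sqrt (D / _) ^+ 2]sqr_sqrtr; last by rewrite divr_ge0// ltW.
have SS : Num.sqrt BB * Num.sqrt BB = BB by rewrite -expr2 sqr_sqrtr// ltW.
have key : D * W ^+ 2 <= D * (2 * Num.sqrt BB / (D / Num.sqrt BB) * Num.sqrt Z ^+ 2 * b ^+ 2).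
  have -> : D * (2 * Num.sqrt BB / (D / Num.sqrt BB) * Num.sqrt Z ^+ 2 * b ^+ 2) =
    2 * (Num.sqrt BB * Num.sqrt BB) * Num.sqrt Z ^+ 2 * b ^+ 2.
    by field; rewrite !gt_eqF.
  rewrite SS; case: Zb => [Z0|b00]; first by rewrite sqr_sqrtr.
  by move: le1; rewrite b00 expr0n /= !mulr0.
by rewrite ler_pM2l in key.
Qed.

End Final.

Theorem lemma2p3 (R : realType) (alpha theta h : R)
    (hh : 0 < h) (halpha0 : 0 < alpha) (halpha1 : alpha <= 1)
    (htheta0 : acos (alpha / 2) <= theta) (htheta1 : theta < pi)
    (C1 : R -> R -> R)
    (hC1 : interpolation_constant alpha theta (C1 alpha theta))
    (u : R * R -> R) (hu : H2 (triK alpha theta h) u)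
    (x0 : R * R) (hx0 : triK alpha theta h x0)
    (hx0' : ~ line p1 (p3 alpha theta h) x0) :
  `|(u \- PiL alpha theta h u) x0| <=
    Num.sqrt (2 * dist p1 x0) / Num.sqrt (height p1 x0 (p3 alpha theta h))
    * Num.sqrt (C1 alpha theta * h * hK alpha theta h
                + C1 alpha theta ^+ 2 * h ^+ 2)
    * seminorm2 (triK alpha theta h) u.
Proof.
have theta0 : 0 < theta.
  by apply: lt_le_trans htheta0; apply: acos_gt0; apply/andP; split; lra.
have sin0 : 0 < sin theta by apply: sin_gt0_pi; rewrite ?theta0.
pose p := alpha * h * cos theta; pose q := alpha * h * sin theta.
have q0 : 0 < q by rewrite !mulr_gt0.
set K := triK alpha theta h in hu hx0 *.
have KE : K = triangle (0, 0) (h, 0) (p, q) by [].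
have mK : measurable K by rewrite KE; exact: triangle_measurable.
have fK : ((@lebesgue_measure R \x @lebesgue_measure R) K < +oo)%E.
  by rewrite KE; exact: triangle_finite_area.
have [cu [uL2 uw] uww] := hu.
have ui := L2_integrable mK fK uL2.
(* The angle lies strictly between 0 and pi, so the vertices are not collinear. *)
have [|[k [l [m PiE]]] Pi1 _ _] := @lagrange_spec R p1 (p2 h) (p3 alpha theta h) u.
  by rewrite /= !subr0 mul0r subr0 mulf_neq0 // gt_eqF.
have PE : PiL alpha theta h u = aff k l m by apply/funext => x; exact: PiE.
have ai : ((@lebesgue_measure R \x @lebesgue_measure R)%E).-integrable K (EFin \o aff k l m).
  have [M M0 KM] := triangle_bounded p hh q0.
  apply: measurable_bounded_integrable => //.
    by apply: measurable_funTS; apply: continuous_measurable2; exact: continuous_aff.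
  exists (`|k| + `|l| * M + `|m| * M); split; first exact: num_real.
  move=> N MN x /KM[x1 x2] /=; apply: le_trans (ltW MN); rewrite /aff.
  apply: (le_trans (ler_normD _ _)); rewrite lerD//.
    by apply: (le_trans (ler_normD _ _)); rewrite lerD// normrM ler_wpM2l.
  by rewrite normrM ler_wpM2l.
set w := u \- PiL alpha theta h u.
have wE : w = u \- aff k l m by rewrite /w PE.
have cw : {within K, continuous w}.
  have ca : {within K, continuous (aff k l m)}.
    by apply: continuous_subspaceT; exact: continuous_aff.
  by rewrite wE => x; apply: cvgB; [exact: cu|exact: ca].
pose G i := weak_partial K i w.
pose g i j := weak_partial K j (weak_partial K i u).
have [wG Gg] : (forall i, is_weak_partial K i w (G i)) /\
    (forall i j, is_weak_partial K j (G i) (g i j)).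
  have H i j := weak2_sub_aff mK fK ai ui (uw i) ((uww i).2 j).
  by rewrite /G wE; split=> i => [|j]; [have [] := H i ord0 | have [] := H i j].
have wi : ((@lebesgue_measure R \x @lebesgue_measure R)%E).-integrable K (EFin \o w).
  by rewrite wE; exact: integrableRB.
have w0 : w (0, 0) = 0.
  by rewrite /w /= (_ : PiL alpha theta h u (0, 0) = u (0, 0)) ?subrr//; exact: Pi1.
have D0 : q * x0.1 - p * x0.2 != 0.
  apply/eqP => D0; apply: hx0'; exists (x0.2 / q).
  apply: injective_projections => /=; rewrite /p1 /= ?subr0 ?add0r ![_ *: _]mulrC -/p -/q.
    apply: (mulfI (lt0r_neq0 q0)).
    by have -> : q * (p * (x0.2 / q)) = p * x0.2; [field; rewrite gt_eqF|lra].
  by field; rewrite gt_eqF.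
have BB0 : 0 < x0.1 ^+ 2 + x0.2 ^+ 2.
  rewrite lt_neqAle addr_ge0 ?sqr_ge0// andbT eq_sym; apply: contra D0.
  by rewrite paddr_eq0 ?sqr_ge0// !sqrf_eq0 => /andP[/eqP-> /eqP->]; rewrite !mulr0 subrr.
set L := hK alpha theta h.
have L0 : 0 < L.
  apply: (lt_le_trans hh); rewrite /L /hK /longest_edge le_max; apply/orP; left.
  by rewrite dist0E /= expr0n /= addr0 sqrtr_sqr ler_norm.
have KL y : K y -> (y.1 - p) ^+ 2 + (y.2 - q) ^+ 2 <= L ^+ 2 by exact: triangle_radius.
have step lam : 0 < lam -> `|q * x0.1 - p * x0.2| * w x0 ^+ 2 <=
   (x0.1 ^+ 2 + x0.2 ^+ 2) * (2 + L * lam) * seminorm1 K w ^+ 2 +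
   (x0.1 ^+ 2 + x0.2 ^+ 2) * (L / lam) * seminorm2 K u ^+ 2.
  move=> lam0.
  have := difference_area hh q0 cw wi wG Gg hx0 D0 L0 lam0 KL.
  rewrite w0 subr0 => /le_trans; apply.
  rewrite (Rintegral_weighted_energy mK wG Gg) /seminorm1 /seminorm2 !sqr_sqrtr//.
    by apply: Rintegral_ge0 => y _; do 2 (apply: sumr_ge0 => ? _); exact: sqr_ge0.
  by apply: Rintegral_ge0 => y _; apply: sumr_ge0 => ? _; exact: sqr_ge0.
have ab : seminorm1 K w <= C1 alpha theta * h * seminorm2 K u by exact: hC1.
have := optimise_weight (ltW BB0) L0 (sqrtr_ge0 _) (sqrtr_ge0 _) ab step.
rewrite (dist0E x0) (heightE (p3 alpha theta h)) ?gt_eqF// -exprMn.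
apply: sqrt_estimate => //; rewrite ?normr_gt0// ?sqrtr_ge0//.
have := sqrtr_ge0 (\int[(@lebesgue_measure R \x @lebesgue_measure R)%E]_(x in K)
    \sum_(i < 2) \sum_(j < 2) weak_partial K j (weak_partial K i u) x ^+ 2).
rewrite -/(seminorm2 K u) le_eqVlt => /orP[/eqP b0|b0]; [by right|left].
have c0 : 0 <= C1 alpha theta * h.
  by rewrite -(pmulr_lge0 _ b0); apply: le_trans ab; exact: sqrtr_ge0.
by rewrite addr_ge0 ?sqr_ge0// mulr_ge0// ltW.
Qed.
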